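(* Let $3\le n\le\infty$ and let $\Gamma\le\mathrm{Sym}(n)$. The kaleidoscopic group $\mathcal{K}(\Gamma)$ is uniformly perfect. More precisely, every element of $\mathcal{K}(\Gamma)$ is the product of three commutators.
   Context: A dendrite is a locally connected continuum (non-empty compact connected metrizable space) containing no simple closed curve. Any two distinct points $x,y$ of a dendrite $X$ are joined by a unique arc $[x,y]$; put $(x,y)=[x,y]\setminus\{x,y\}$. For $x\in X$, $\widehat{x}=\pi_0(X\setminus\{x\})$ is the (at most countable) set of components of $X\setminus\{x\}$; $x$ is a branch point if $|\widehat{x}|\ge 3$, and $\mathrm{Br}(X)$ is the (at most countable) set of branch points. For $3\le n\le\infty$ ($\infty$ meaning countably infinite), the Ważewski dendrite $D_n$ is the dendrite, unique up to homeomorphism, which is not a single point, in which $|\widehat{x}|=n$ for every branch point $x$, and in which $(x,y)$ contains a branch point for all $x\ne y$. Write $[n]=\{m\in\mathbf{N}: m<n\}$ (so $[\infty]=\mathbf{N}\ni 0$) and $\mathrm{Sym}(n)$ for the group of all permutations of $[n]$. A coloring of $D_n$ is a map $c$ from $\widehat{D_n}=\bigsqcup_{x\in\mathrm{Br}(D_n)}\widehat{x}$ to $[n]$ whose restriction $c_x=c|_{\widehat{x}}$ is a bijection $\widehat{x}\to[n]$ for each $x\in \mathrm{Br}(D_n)$; for $y\ne x$, $c_x(y)$ denotes the color of the component of $D_n\setminus\{x\}$ containing $y$. The coloring is kaleidoscopic if for all distinct $x,y\in\mathrm{Br}(D_n)$ and all distinct $i,j\in[n]$ there is $z\in(x,y)\cap\mathrm{Br}(D_n)$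 with $c_z(x)=i$ and $c_z(y)=j$. For $g\in\mathrm{Homeo}(D_n)$ and $x\in\mathrm{Br}(D_n)$ put $\sigma_c(g,x)=c_{g(x)}\circ g\circ c_x^{-1}\in\mathrm{Sym}(n)$, where $g$ is viewed as a bijection $\widehat{x}\to\widehat{g(x)}$. For $\Gamma\le\mathrm{Sym}(n)$ put $\mathcal{K}_c(\Gamma)=\{g\in\mathrm{Homeo}(D_n):\sigma_c(g,x)\in\Gamma\ \text{for all } x\in\mathrm{Br}(D_n)\}$. Kaleidoscopic colorings exist and for any two of them, $c$ and $d$, the groups $\mathcal{K}_c(\Gamma)$ and $\mathcal{K}_d(\Gamma)$ are conjugate in $\mathrm{Homeo}(D_n)$; $\mathcal{K}(\Gamma)$ denotes $\mathcal{K}_c(\Gamma)$ for some (any) kaleidoscopic coloring $c$. A group is uniformly perfect if there is an integer $k$ such that every element is a product of $k$ commutators. *)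

(* Defs.v *)
From HB Require Import structures.
From mathcomp Require Import all_boot all_order all_algebra.
From mathcomp Require Import all_classical all_reals all_analysis.

Set Implicit Arguments.
Unset Strict Implicit.
Unset Printing Implicit Defensive.

Import Order.TTheory GRing.Theory Num.Theory.
Import numFieldTopology.Exports numFieldNormedType.Exports.

Local Open Scope classical_set_scope.
Local Open Scope ring_scope.

Definition is_subgroup (gT : groupType) (G : set gT) : Prop :=
  [/\ G 1%g,
      forall a b, G a -> G b -> G (a * b)%g &
      forall a, G a -> G (a^-1)%g].

Definition product_of_commutators (gT : groupType) (G : set gT) (k : nat)
    (g : gT) : Prop :=
  exists a b : 'I_k -> gT,
    [/\ forall i, G (a i), forall i, G (b i) &
        g = (\prod_(i < k) [~ a i, b i])%g].

Definition uniformly_perfect (gT : groupType) (G : set gT) : Prop :=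
  exists k : nat, forall g, G g -> product_of_commutators G k g.

(* Two-sided inverse kept as data; the product is (g * h) x = g (h x). *)

Record sym (T : Type) := Sym {
  sym_fun :> T -> T;
  sym_inv : T -> T;
  symK : cancel sym_fun sym_inv;
  symVK : cancel sym_inv sym_fun
}.

Section SymGroup.
Variable T : Type.
Implicit Types f g h : sym T.

HB.instance Definition _ := gen_eqMixin (sym T).
HB.instance Definition _ := gen_choiceMixin (sym T).

Lemma symP f g : f =1 g -> f = g.
Proof.
move=> fg; have ffg : sym_fun f = sym_fun g by apply/funext.
have ifg : sym_inv f = sym_inv g.
  by apply/funext => x; rewrite -[in LHS](symVK g x) -fg symK.
case: f g ffg ifg {fg} => f f' fK f'K [g g' gK g'K] /= fg fg'.
by subst f f'; congr Sym; exact: Prop_irrelevance.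
Qed.

Definition sym_one : sym T := @Sym T idfun idfun (frefl _) (frefl _).
Definition sym_invg f : sym T := Sym (symVK f) (symK f).
Definition sym_mul f g : sym T :=
  Sym (can_comp (symK f) (symK g)) (can_comp (symVK g) (symVK f)).

Let mulA : associative sym_mul. Proof. by move=> f g h; exact: symP. Qed.
Let mul1 : left_id sym_one sym_mul. Proof. by move=> f; exact: symP. Qed.
Let mulx1 : right_id sym_one sym_mul. Proof. by move=> f; exact: symP. Qed.
Let mulV : left_inverse sym_one sym_invg sym_mul.
Proof. by move=> f; apply: symP => x /=; rewrite symK. Qed.
Let mulxV : right_inverse sym_one sym_invg sym_mul.
Proof. by move=> f; apply: symP => x /=; rewrite symVK. Qed.

HB.instance Definition _ := isGroup.Build (sym T) mulA mul1 mulx1 mulV mulxV.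

Lemma sym1E x : (1%g : sym T) x = x. Proof. by []. Qed.
Lemma symME f g x : (f * g)%g x = f (g x). Proof. by []. Qed.
Lemma symVE f x : (f^-1)%g x = sym_inv f x. Proof. by []. Qed.

End SymGroup.

Definition homeos (X : topologicalType) : set (sym X) :=
  [set g : sym X | continuous g /\ continuous (g^-1 : sym X)%g].

(* [None] stands for n = oo. *)

Definition colors (n : option nat) : set nat :=
  if n is Some m then `I_m else [set: nat].

Definition at_least3 (n : option nat) : bool :=
  if n is Some m then (3 <= m)%N else true.

Definition Symn (n : option nat) : groupType := sym (colors n).

Definition set_homeo (T U : topologicalType) (A : set T) (B : set U)
    (f : T -> U) : Prop :=
  [/\ set_bij A B f, {within A, continuous f} &
      exists2 g : U -> T, {in A, cancel f g} & {within B, continuous g}].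

Definition locally_connected (X : topologicalType) : Prop :=
  forall (x : X) (U : set X), nbhs x U ->
    exists V : set X, [/\ open V, V x, connected V & V `<=` U].

Section Dendrites.
Context {R : realType} (X : metricType R).

Definition circle : set (R * R) := [set p | p.1 ^+ 2 + p.2 ^+ 2 = 1].

Definition simple_closed_curve (C : set X) : Prop :=
  exists f : R * R -> X, set_homeo circle C f.

Definition dendrite : Prop :=
  [/\ [set: X] !=set0, compact [set: X], connected [set: X],
      locally_connected X & ~ exists C, simple_closed_curve C].

Definition arc_between (x y : X) (A : set X) : Prop :=
  exists f : R -> X, [/\ set_homeo (`[0, 1] : set R) A f, f 0 = x & f 1 = y].

(* In a dendrite there is exactly one arc between two distinct points; outside
   of that case the chosen set carries no information. *)
Definition arc (x y : X) : set X := xget set0 [set A | arc_between x y A].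

Definition open_arc (x y : X) : set X := arc x y `\` [set x; y].

(* The component of the complement of x that contains y, for y <> x. *)
Definition comp_at (x y : X) : set X := connected_component (~` [set x]) y.

Definition hat (x : X) : set (set X) := [set comp_at x y | y in ~` [set x]].

Definition branch : set X := [set x | (`I_3 #<= hat x)%card].

Definition wazewski (n : option nat) : Prop :=
  [/\ dendrite,
      exists x y : X, x <> y,
      forall x, branch x -> (hat x #= colors n)%card &
      forall x y : X, x <> y -> open_arc x y `&` branch !=set0].

End Dendrites.

Section Kaleidoscopic.
Context {R : realType} (X : metricType R) (n : option nat).
Implicit Types (c : X -> set X -> colors n) (g : sym X).

(* [c x C] is c_x(C); it is only meaningful when x is a branch point and C is a
   component of the complement of x. *)
Definition coloring c : Prop :=
  forall x, branch x -> set_bij (hat x) [set: colors n] (c x).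

Definition kaleidoscopic c : Prop :=
  coloring c /\
  forall x y : X, branch x -> branch y -> x <> y ->
  forall i j : colors n, i <> j ->
  exists z : X, [/\ open_arc x y z, branch z,
    c z (comp_at z x) = i & c z (comp_at z y) = j].

(* sigma_c(g, x) = c_{g(x)} \o g \o c_x^{-1}; a coloring makes the inverse of
   [c x] on [hat x] a genuine one. *)
Definition local_action c g (x : X) : colors n -> colors n :=
  fun i => c (g x) (g @` 'pinv_(fun=> set0) (hat x) (c x) i).

Definition kaleidoscopic_group c (Gamma : set (Symn n)) : set (sym X) :=
  [set g | homeos g /\ forall x, branch x ->
     exists2 s : Symn n, Gamma s & local_action c g x = s :> (_ -> _)].

Lemma homeosV g : homeos g -> homeos (g^-1)%g.
Proof. by case=> gc gVc; split=> //; rewrite invgK. Qed.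

Lemma image_comp_at_sub g x y : homeos g ->
  g @` comp_at x y `<=` comp_at (g x) (g y).
Proof.
move=> [gc _] _ [z [C [Cy Cx Cc] Cz] <-]; exists (g @` C) => /=; last by exists z.
split; first by exists y.
  move=> _ [w /Cx wx <-] /= /(can_inj (symK g)); exact: wx.
by apply: connected_continuous_connected => //; exact: continuous_subspaceT.
Qed.

Lemma image_comp_at g x y : homeos g ->
  g @` comp_at x y = comp_at (g x) (g y).
Proof.
move=> gh; apply/seteqP; split; first exact: image_comp_at_sub.
move=> z gz; exists ((g^-1)%g z); last by rewrite symVE symVK.
have := @image_comp_at_sub _ (g x) (g y) (homeosV gh).
by rewrite !symVE !symK; apply; exists z.
Qed.

Lemma image_hat g x : homeos g -> set_bij (hat x) (hat (g x)) (fun C => g @` C).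
Proof.
move=> gh; split.
- move=> _ [y yx <-]; rewrite /= image_comp_at//; exists (g y) => //=.
  by move/(can_inj (symK g)).
- move=> C D _ _ /= gCD; apply/seteqP; split=> z Cz.
    have : (g @` D) (g z) by rewrite -gCD; exists z.
    by case=> w Dw /(can_inj (symK g)) <-.
  have : (g @` C) (g z) by rewrite gCD; exists z.
  by case=> w Dw /(can_inj (symK g)) <-.
- move=> _ [y yx <-]; exists (comp_at x (sym_inv g y)).
    exists (sym_inv g y) => //= yx'; apply: yx => /=.
    by rewrite -yx' symVK.
  by rewrite image_comp_at// symVK.
Qed.

Lemma homeo_branch g x : homeos g -> branch (g x) <-> branch x.
Proof.
move=> gh; rewrite /branch /=.
have e : (hat x #= hat (g x))%card by apply/card_set_bijP; eexists; exact: image_hat.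
by rewrite (card_le_eqr e).
Qed.

Lemma local_actionE c g x C : coloring c -> branch x -> hat x C ->
  local_action c g x (c x C) = c (g x) (g @` C).
Proof.
move=> cc bx xC; have [_ ci _] := cc _ bx.
by rewrite /local_action pinvKV// inE.
Qed.

Lemma local_actionP c g x (s : colors n -> colors n) : coloring c -> branch x ->
  (forall C, hat x C -> s (c x C) = c (g x) (g @` C)) ->
  local_action c g x = s.
Proof.
move=> cc bx sE; apply/funext => i.
have [_ _ /(_ i Logic.I) [C xC <-]] := cc _ bx.
by rewrite local_actionE// sE.
Qed.

Lemma kaleidoscopic_group_subgroup c (Gamma : set (Symn n)) :
  coloring c -> is_subgroup Gamma -> is_subgroup (kaleidoscopic_group c Gamma).
Proof.
move=> cc [G1 GM GV]; split.
- split; first by split=> x; exact: cvg_id.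
  move=> x bx; exists 1%g => //; apply: local_actionP => // C xC.
  by rewrite !sym1E image_id.
- move=> g h [gh gG] [hh hG]; have ghh : homeos (g * h)%g.
    case: gh hh => [gc gVc] [hc hVc]; split=> [|] x.
      by apply: continuous_comp; [exact: hc|exact: gc].
    by rewrite invgM; apply: continuous_comp; [exact: gVc|exact: hVc].
  split=> // x bx; have bhx : branch (h x) by apply/homeo_branch.
  have [s Gs sE] := gG _ bhx; have [t Gt tE] := hG _ bx.
  exists (s * t)%g; first exact: GM.
  apply: local_actionP => // C xC; have [hf _ _] := image_hat x hh.
  rewrite symME -tE local_actionE// -sE local_actionE//; last exact: hf.
  by rewrite image_comp.
- move=> g [gh gG]; have gVh := homeosV gh; split=> // x bx.
  have bgx : branch ((g^-1)%g x) by apply/homeo_branch.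
  have [s Gs sE] := gG _ bgx; exists (s^-1)%g; first exact: GV.
  apply: local_actionP => // C xC; have [hf _ _] := image_hat x gVh.
  apply: (can_inj (symK s)); rewrite !symVE symVK -sE local_actionE//.
    rewrite symVE symVK image_comp; congr (c x _).
    by rewrite -[LHS]image_id; apply: eq_imagel => z _ /=; rewrite symVK.
  exact: hf.
Qed.

End Kaleidoscopic.

(* Main.v *)
(* If an interior point z of an arc did not separate its endpoints, local
   connectedness would give a path, hence an arc, joining them off z, and the
   two arcs would contain a simple closed curve. So the components of the
   complements of the branch points form a subbasis, and X is determined by the
   countable tree of its branch points, on which a kaleidoscopic coloring is
   homogeneous by back-and-forth.

   If g in K(Gamma) moves a branch point x, there is a branch point p such that
   x and g x are not separated by p, and p and g p are not separated by g x. By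
   back-and-forth some k in K(Gamma), supported in the component U of X \ {p}
   containing x, agrees with g at x and on the components of X \ {x}. Then
   k^-1 g = b a with a supported in the component V of X \ {x} containing p
   and b supported off V, hence in U. Thus g = (k b) a, where both factors are
   supported in a component of the complement of a branch point. Such an element
   is a commutator, because that component can be displaced off itself by all
   positive powers of a translation. Two commutators therefore suffice. *)

From HB Require Import structures.
Require Import Defs.
From mathcomp Require Import all_boot all_order all_algebra.
From mathcomp Require Import all_classical all_reals all_analysis.
From mathcomp Require Import lra zify.

Set Implicit Arguments.
Unset Strict Implicit.
Unset Printing Implicit Defensive.

Import Order.TTheory GRing.Theory Num.Theory.
Import numFieldTopology.Exports numFieldNormedType.Exports.

Local Open Scope classical_set_scope.
Local Open Scope ring_scope.

(** * Paths in locally connected compact metric spaces *)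

(** The obstacle is that back-and-forth only produces maps preserving colors, whereas [k] must act
    at x by the permutation s that [g] induces there. So the target coloring is changed: at g x the
    colors are twisted by the inverse of s, and a map preserving colors from [c] to the twisted
    coloring has local action s at x and trivial local action elsewhere. The two conditions on p say
    precisely that p -> p, x -> g x is a legitimate start for this back-and-forth: the first at p,
    the second at g x.

    Once arcs are known to separate, everything is phrased by equality of components [comp_at] and
    by colors. A bijection compatible with these is a homeomorphism, which is why restrictions to a
    component and infinite products with disjoint supports cost no topology. A third color enters
    three times: to count branch points, to hang disjoint branches off an axis, and to find p off an
    arc. *)

Lemma nbhs_mdistE (R : realType) (X : metricType R) (x : X) (A : set X) :
  nbhs x A <-> exists2 e, 0 < e & forall y, mdist x y < e -> A y.
Proof.
by rewrite -metricType_numDomainType.filter_from_mdist_nbhs; split => -[e e0 h];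
  exists e.
Qed.

Lemma cvg_mdistE (R : realType) (X : metricType R) (f : R -> X) (t : R) (x : X)
  :
  f s @[s --> t] --> x <->
  forall e, 0 < e -> exists2 d, 0 < d &
    forall s, `|t - s| < d -> mdist x (f s) < e.
Proof.
rewrite metricType_numDomainType.cvgrPdist_lt; split => h e /h.
  by move=> /nbhs_ballP[d d0 dh]; exists d => // s ts; exact: dh.
by case=> d d0 dh; apply/nbhs_ballP; exists d => // s ts; exact: dh.
Qed.

(** A locally constant property cuts out a relatively clopen part of [S]. Both the existence of
    chains and that of paths are proved this way. *)
Lemma connected_ind (T : topologicalType) (S : set T) (P : T -> Prop) a :
  connected S -> S a -> P a ->
  (forall x, S x -> exists2 V, nbhs x V & forall y, S y -> V y -> (P x <-> P
    y)) ->
  forall b, S b -> P b.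
Proof.
move=> cS Sa Pa loc b Sb.
have E : S `&` P = S.
  apply: cS; first by exists a.
    exists (interior [set y | S y -> P y]); first exact: open_interior.
    apply/seteqP; split => x [Sx Px]; split => //;
      last exact: (interior_subset Px).
    have [V Vx h] := loc x Sx; apply: filterS Vx => y Vy Sy.
    by apply/(h y Sy Vy).
  exists (~` (interior [set y | S y -> ~ P y])).
    by apply: open_closedC; exact: open_interior.
  apply/seteqP; split => x [Sx Px]; split => //.
    by move=> /interior_subset; apply.
  have [V Vx h] := loc x Sx; apply: contrapT => nPx; apply: Px.
  apply: filterS Vx => y Vy Sy Py; apply: nPx.
  by apply/(h y Sy Vy).
by have [] : (S `&` P) b by rewrite E.
Qed.

Lemma nat_dependent_choice (T : Type) (P : nat -> T -> Prop)
    (Q : nat -> T -> T -> Prop) (x : T) :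
  P 0%N x -> (forall n s, P n s -> exists s', P n.+1 s' /\ Q n s s') ->
  exists u : nat -> T, u 0%N = x /\ forall n, P n (u n) /\ Q n (u n) (u n.+1).
Proof.
move=> P0 step.
have /choice[F FP] : forall ns : nat * T,
    exists s', P ns.1 ns.2 -> P ns.1.+1 s' /\ Q ns.1 ns.2 s'.
  move=> [n s]; have [/step[s' h]|h] := pselect (P n s); first by exists s'.
  by exists s.
pose u := fix u n := if n is m.+1 then F (m, u m) else x.
have Pu n : P n (u n) by elim: n => //= n IH; have [] := FP (n, u n) IH.
by exists u; split => // n; split => //; have [] := FP (n, u n) (Pu n).
Qed.

Section LocallyConnectedPaths.
Context {R : realType} (X : metricType R).

(** The small connected set is kept, not just the distance: it is what allows a link to be replaced
    by a chain of finer links that stays close to it. *)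
Definition linked (e : R) (a b : X) := exists S : set X,
  [/\ connected S, S a, S b & forall u v, S u -> S v -> mdist u v < e].

Lemma linkedxx e a : 0 < e -> linked e a a.
Proof.
move=> e0; exists [set a]; split=> //; first exact: connected1.
by move=> u v -> ->; rewrite mdistxx.
Qed.

Lemma linked_nbhs e a : locally_connected X -> 0 < e ->
  nbhs a [set b | linked e a b /\ linked e b a].
Proof.
move=> lc e0; have e20 : 0 < e / 2 by rewrite divr_gt0.
have /lc[V [oV Va cV Vb]] : nbhs a [set b | mdist a b < e / 2].
  by apply/nbhs_mdistE; exists (e / 2).
apply: filterS (open_nbhs_nbhs (conj oV Va)) => b Vb'.
have dV u v : V u -> V v -> mdist u v < e.
  move=> /Vb /= ua /Vb /= va; rewrite (splitr e).
  by rewrite (le_lt_trans (metric_triangle _ a _))// ltrD// metric_sym.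
by split; exists V.
Qed.

Lemma linked_chain (S : set X) e a b :
  locally_connected X -> connected S -> S a -> S b -> 0 < e ->
  exists (f : nat -> X) N, [/\ f 0%N = a, forall k, (N <= k)%N -> f k = b,
    forall k, S (f k) & forall k, linked e (f k) (f k.+1)].
Proof.
move=> lc cS Sa Sb e0; move: b Sb.
have ext x y : S y -> linked e x y ->
  (exists (f : nat -> X) N, [/\ f 0%N = a, forall k, (N <= k)%N -> f k = x,
    forall k, S (f k) & forall k, linked e (f k) (f k.+1)]) ->
  (exists (f : nat -> X) N, [/\ f 0%N = a, forall k, (N <= k)%N -> f k = y,
    forall k, S (f k) & forall k, linked e (f k) (f k.+1)]).
  move=> Sy xy [f [N [f0 fN fS fl]]].
  exists (fun k => if (k <= N)%N then f k else y), N.+1; split => //.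
  - by move=> k; rewrite ltnNge => /negbTE ->.
  - by move=> k; case: ifP.
  - move=> k; case: ifP => kN; case: ifP => // k1N.
    + suff -> : f k = x by [].
      by apply: fN; move: k1N; rewrite -ltnS; lia.
    + by rewrite (ltnW k1N) in kN.
    + exact: linkedxx.
apply: (connected_ind cS Sa).
  exists (fun=> a), 0%N; split=> // _; exact: linkedxx.
move=> x Sx; exists [set b | linked e x b /\ linked e b x].
  exact: linked_nbhs.
by move=> y Sy [xy yx]; split; apply: ext.
Qed.

Definition chain_level (e : R) (a b : X) (n : nat) (s : (nat -> X) * nat) :=
  [/\ (0 < s.2)%N, s.1 0%N = a, forall k, (s.2 <= k)%N -> s.1 k = b &
   forall k, linked (e / 2 ^+ n) (s.1 k) (s.1 k.+1)].

(** Every link is subdivided into the same number [N] of links. The point of the coarse chain at a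
    time t in [0, 1] is then found by dividing the fine index by [N], and all levels share one
    parametrization. *)
Definition chain_refines (e : R) (n : nat) (s s' : (nat -> X) * nat) :=
  exists N, [/\ (0 < N)%N, s'.2 = (s.2 * N)%N &
    forall k, mdist (s.1 (k %/ N)%N) (s'.1 k) < e / 2 ^+ n].

Lemma chain_refine e a b n s : locally_connected X -> 0 < e ->
  chain_level e a b n s ->
  exists s', chain_level e a b n.+1 s' /\ chain_refines e n s s'.
Proof.
move=> lc e0 [M0 f0 fM fl]; case: s M0 f0 fM fl => f M /= M0 f0 fM fl.
have en m : 0 < e / 2 ^+ m by rewrite divr_gt0// exprn_gt0.
have /choice[G GP] : forall k, exists gN : (nat -> X) * nat,
    [/\ gN.1 0%N = f k, forall m, (gN.2 <= m)%N -> gN.1 m = f k.+1,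
     forall m, mdist (f k) (gN.1 m) < e / 2 ^+ n &
     forall m, linked (e / 2 ^+ n.+1) (gN.1 m) (gN.1 m.+1)].
  move=> k; have [S [cS Sk Sk1 dS]] := fl k.
  have [g [N [g0 gN gS gl]]] := linked_chain lc cS Sk Sk1 (en n.+1).
  by exists (g, N); split=> //= m; apply: dS.
(* A common length for all subdivisions: it exceeds the length of each one, and the shorter ones are
   padded by their final value. *)
pose N := (\sum_(k < M) (G k).2).+1.
pose g k := if (k < M)%N then (G k).1 else (fun=> b).
have g0 k : g k 0%N = f k.
  by rewrite /g; case: ltnP => [_|/fM//]; have [] := GP k.
have gN k : g k N = f k.+1.
  rewrite /g; case: ltnP => [kM|Mk]; last by rewrite fM// (leq_trans Mk).
  have [_ -> //] := GP k; rewrite /N (bigD1 (Ordinal kM))//=; lia.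
have gl k m : linked (e / 2 ^+ n.+1) (g k m) (g k m.+1).
  rewrite /g; case: ifP => _; first by have [] := GP k.
  exact: linkedxx.
have gd k m : mdist (f k) (g k m) < e / 2 ^+ n.
  rewrite /g; case: ltnP => [_|/fM ->]; first by have [] := GP k.
  by rewrite mdistxx.
exists (fun m => g (m %/ N)%N (m %% N)%N, (M * N)%N); split; last first.
  by exists N; split => //= k.
split => /=.
- by rewrite muln_gt0 M0.
- by rewrite div0n mod0n g0.
- by move=> k; rewrite -leq_divRL// => Mk; rewrite /g ltnNge Mk.
- move=> k; have [kN|kN] := ltnP (k %% N).+1 N.
    have -> : (k.+1 = (k %/ N) * N + (k %% N).+1)%N.
      by rewrite {1}(divn_eq k N) addnS.
    by rewrite divnMDl// modnMDl (divn_small kN) (modn_small kN) addn0.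
  have kN' : (k %% N).+1 = N by apply/eqP; rewrite eqn_leq kN ltn_pmod.
  have -> : (k.+1 = (k %/ N).+1 * N)%N.
    by rewrite {1}(divn_eq k N) -addnS kN' mulSn addnC.
  rewrite mulnK// modnMl g0.
  by have := gl (k %/ N)%N (k %% N)%N; rewrite kN' gN.
Qed.

(** Truncation jumps, but by at most one near a given point. Nearby times therefore select equal or
    consecutive points of a chain, and these are linked. *)
Lemma truncn_near (x : R) : exists2 d, 0 < d & forall y, `|x - y| < d ->
  Num.truncn y = Num.truncn x \/ Num.truncn x = (Num.truncn y).+1.
Proof.
set k := Num.truncn x.
have xk : x < k.+1%:R by rewrite /k truncnS_gt.
exists (Num.min 1 (k.+1%:R - x)).
  by rewrite lt_min ltr01 subr_gt0.
move=> y; rewrite lt_min => /andP[xy1 xyk].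
have yk : y < k.+1%:R by move: xyk; rewrite ltr_norml => /andP[]; lra.
have yk' : (Num.truncn y <= k)%N by rewrite truncn_le_nat.
have [x0|x0] := ltP x 0.
  left; apply/eqP; rewrite eqn_leq yk'/= /k.
  suff -> : Num.truncn x = 0%N by [].
  apply/eqP; rewrite -leqn0 truncn_le_nat; lra.
have kx : k%:R <= x by rewrite truncn_le.
case: k kx {xk xyk yk} yk' => [|k] kx yk'; first by left; lia.
suff : (k <= Num.truncn y)%N by lia.
case: k kx {yk'} => // k kx.
rewrite truncn_gt_nat; move: xy1; rewrite ltr_norml => /andP[_].
move: kx; rewrite -(natr1 k.+1); lra.
Qed.

(** The chains of level n define step functions [G n] on [0, 1], and consecutive levels differ by
    less than [en n] uniformly. Their limit is the path; its jumps vanish because links of level n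
    have size below [en n]. The factor 4 is 1 for the distance from a to [G 0] plus 3 for the
    distance from [G 0] to the limit. *)
Lemma linked_path e a b : locally_connected X -> compact [set: X] -> 0 < e ->
  linked e a b ->
  exists g : R -> X, [/\ continuous g, g 0 = a, g 1 = b &
    forall t, mdist a (g t) < 4 * e].
Proof.
move=> lc cX e0 ab.
pose en n := e / 2 ^+ n.
have en0 n : 0 < en n by rewrite divr_gt0// exprn_gt0.
have enS n : en n.+1 = en n / 2 by rewrite /en exprS invfM mulrCA mulrC.
have P0 : chain_level e a b 0 (fun k => if k is 0%N then a else b, 1%N).
  split => //=; first by case.
  by case=> [|k] /=; rewrite expr0 divr1//; exact: linkedxx.
have step n s : chain_level e a b n s ->
    exists s', chain_level e a b n.+1 s' /\ chain_refines e n s s'.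
  exact: chain_refine.
have [u [u0 uP]] := nat_dependent_choice P0 step.
pose f n := (u n).1; pose M n := (u n).2.
pose G n (t : R) := f n (Num.truncn (t * (M n)%:R)).
have GS n t : mdist (G n t) (G n.+1 t) < en n.
  have [_ [N [N0 MN h]]] := uP n.
  rewrite /G /f /M; set k := Num.truncn (t * (u n.+1).2%:R).
  suff -> : Num.truncn (t * (u n).2%:R) = (k %/ N)%N by exact: h.
  rewrite /k MN natrM mulrA; set x := t * _;
    have N0' : 0 < N%:R :> R by rewrite ltr0n.
  have [x0|x0] := ltP x 0.
    have -> : Num.truncn x = 0%N by apply/eqP; rewrite -leqn0 truncn_le_nat;
      lra.
    suff -> : Num.truncn (x * N%:R) = 0%N by rewrite div0n.
    by apply/eqP; rewrite -leqn0 truncn_le_nat;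
      rewrite (lt_trans _ ltr01)// pmulr_llt0.
  apply: truncn_def; have xN0 : 0 <= x * N%:R by rewrite mulr_ge0.
  have /andP[h1 h2] := truncn_itv xN0.
  set m := Num.truncn _ in h1 h2 *; apply/andP; split.
    rewrite -(ler_pM2r N0') (le_trans _ h1)// -natrM ler_nat;
      exact: leq_trunc_div.
  rewrite -(ltr_pM2r N0') (lt_le_trans h2)// -natrM ler_nat; exact: ltn_ceil.
have GD n m t : mdist (G n t) (G (n + m)%N t) <= 2 * en n - 2 * en (n + m)%N.
  elim: m => [|m IH]; first by rewrite addn0 mdistxx subrr.
  rewrite (le_trans (metric_triangle _ (G (n + m)%N t) _))//.
  by have := GS (n + m)%N t; rewrite addnS enS; lra.
(* The limit is taken as a cluster point: [2 * en n] bounds the tail of the sequence, and one more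
   [en n] the distance from the tail to the cluster point. *)
have /choice[g gP] : forall t, exists p, forall n, mdist (G n t) p <= 3 * en n.
  move=> t; have : ProperFilter (G ^~ t @ \oo) by exact: fmap_proper_filter.
  move=> /cX /(_ filterT)[p [_ cp]]; exists p => n.
  have Gn : (G ^~ t @ \oo) [set q | mdist (G n t) q <= 2 * en n].
    exists n => //= m /= nm; have := GD n (m - n)%N t; rewrite subnKC//.
    by have := en0 m; lra.
  have np : nbhs p [set q | mdist p q < en n].
    by apply/nbhs_mdistE; exists (en n).
  have [q [/= qn pq]] := cp _ _ Gn np.
  have := metric_triangle (G n t) q p.
  by rewrite [mdist q p]metric_sym; move: qn pq; lra.
have limE (p q : X) : (forall n, mdist p q <= 3 * en n) -> p = q.
  move=> h; apply: mdist_positivity; apply/eqP; rewrite eq_le mdist_ge0 andbT.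
  apply/ler_addgt0Pl => z z0; rewrite addr0;
    have ez : 0 < 3 * e / z by rewrite divr_gt0// mulr_gt0.
  have := truncnS_gt (3 * e / z); set k := (Num.truncn _).+1 => ek.
  have k2 : k%:R < 2 ^+ k :> R by rewrite -natrX ltr_nat ltn_expl.
  apply: (le_trans (h k)); rewrite /en mulrA ler_pdivrMr ?exprn_gt0//.
  rewrite [z * _]mulrC -ler_pdivrMr//; exact: (ltW (lt_trans ek k2)).
have gcont : continuous g.
  move=> t; apply/cvg_mdistE => z z0.
  (* 7 = 3 + 1 + 3: from [g t] to [G n t], then to [G n s], then to [g s]. *)
  have [n nz] : exists n, 7 * en n < z.
    have := truncnS_gt (7 * e / z); set k := (Num.truncn _).+1 => ek.
    have k2 : k%:R < 2 ^+ k :> R by rewrite -natrX ltr_nat ltn_expl.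
    exists k; rewrite /en mulrA ltr_pdivrMr ?exprn_gt0//.
    by rewrite [z * _]mulrC -ltr_pdivrMr// (lt_trans ek).
  have [[M0 _ _ fl] _] := uP n.
  have M0' : 0 < (M n)%:R :> R by rewrite ltr0n.
  have [d d0 dh] := truncn_near (t * (M n)%:R).
  exists (d / (M n)%:R); first by rewrite divr_gt0.
  move=> s ts.
  have Gst : mdist (G n t) (G n s) < en n.
    have : `|t * (M n)%:R - s * (M n)%:R| < d.
      by rewrite -mulrBl normrM (gtr0_norm M0') -ltr_pdivlMr.
    move=> /dh[|]; rewrite /G => ->; first by rewrite mdistxx.
    have [S [_ S1 S2 dS]] := fl (Num.truncn (s * (M n)%:R)); exact: dS.
  rewrite (le_lt_trans _ nz)// (le_trans (metric_triangle _ (G n t) _))//.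
  have := metric_triangle (G n t) (G n s) (g s).
  by have := gP t n; have := gP s n; rewrite [mdist _ (g t)]metric_sym; lra.
exists g; split => //.
- apply/esym/limE => n; suff -> : a = G n 0 by exact: gP.
  by have [[_ f0 _ _] _] := uP n; rewrite /G mul0r truncn0 /f f0.
- apply/esym/limE => n; suff -> : b = G n 1 by exact: gP.
  by have [[_ _ fM _] _] := uP n; rewrite /G mul1r natrK /f fM.
- move=> t; have en0E : en 0%N = e by rewrite /en expr0 divr1.
  have aG : mdist a (G 0%N t) < e.
    rewrite /G /f u0 /=; case: (Num.truncn _) => [|_]; first by rewrite mdistxx.
    by have [S [_ Sa Sb dS]] := ab; exact: dS.
  have := gP t 0%N; rewrite en0E => h.
  rewrite (le_lt_trans (metric_triangle _ (G 0%N t) _))//; lra.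
Qed.

Lemma continuous_glue (f g : R -> X) c : continuous f -> continuous g ->
  f c = g c -> continuous (fun t => if t <= c then f t else g t).
Proof.
move=> fC gC fgc t; apply/cvg_mdistE => e e0.
have [d1 d10 h1] := (cvg_mdistE f t _).1 (fC t) e e0.
have [d2 d20 h2] := (cvg_mdistE g t _).1 (gC t) e e0.
have [tc|ct|tc] := ltgtP t c.
- exists (Num.min d1 (c - t)); first by rewrite lt_min d10 subr_gt0.
  move=> s; rewrite lt_min => /andP[sd]; rewrite ltr_norml => /andP[sc _].
  have -> : s <= c by move: sc; lra.
  exact: h1.
- exists (Num.min d2 (t - c)); first by rewrite lt_min d20 subr_gt0.
  move=> s; rewrite lt_min => /andP[sd]; rewrite ltr_norml => /andP[_ sc].
  have -> : (s <= c) = false by apply/negbTE; rewrite -ltNge; move: sc; lra.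
  exact: h2.
- exists (Num.min d1 d2); first by rewrite lt_min d10 d20.
  move=> s; rewrite lt_min => /andP[sd1 sd2].
  by case: ifP => _; [exact: h1|rewrite tc fgc -tc; exact: h2].
Qed.

Lemma open_connected_path (U : set X) x y : locally_connected X ->
  compact [set: X] -> open U -> connected U -> U x -> U y ->
  exists g : R -> X, [/\ continuous g, g 0 = x, g 1 = y & forall t, U (g t)].
Proof.
move=> lc cX oU cU Ux; move: y.
have cat a b :
  (exists g : R -> X, [/\ continuous g, g 0 = x, g 1 = a & forall t, U (g t)])
    ->
  (exists g : R -> X, [/\ continuous g, g 0 = a, g 1 = b & forall t, U (g t)])
    ->
  (exists g : R -> X, [/\ continuous g, g 0 = x, g 1 = b & forall t, U (g t)]).
  move=> [f [fC f0 f1 fU]] [g [gC g0 g1 gU]].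
  exists (fun t => if t <= 2^-1 then f (2 * t) else g (2 * t - 1)); split.
  - apply: (@continuous_glue (fun t => f (2 * t)) (fun t => g (2 * t - 1))).
    + by move=> t; apply: continuous_comp; [exact: mulrl_continuous|exact: fC].
    + move=> t; apply: continuous_comp; last exact: gC.
      by apply: cvgB; [exact: mulrl_continuous|exact: cvg_cst].
    + by rewrite divff// subrr f1 g0.
  - by rewrite invr_ge0 ler0n mulr0.
  - rewrite mulr1 ifN; last by rewrite -ltNge; lra.
    by rewrite (_ : 2 - 1 = 1) ?g1//; lra.
  - by move=> t; case: ifP.
apply: (connected_ind cU Ux).
  by exists (fun=> x); split => //; exact: cst_continuous.
move=> a Ua; have /nbhs_mdistE[e e0 eU] := open_nbhs_nbhs (conj oU Ua).
(* The factor 4 in [linked_path] turns [e / 4] into a path inside the ball of radius [e]. *)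
have e40 : 0 < e / 4 by rewrite divr_gt0.
exists [set b | linked (e / 4) a b /\ linked (e / 4) b a].
  exact: linked_nbhs.
move=> b Ub [/(linked_path lc cX e40)[g [gC g0 g1 ga]] _].
have gU t : U (g t) by apply: eU; have := ga t; lra.
split => /cat; apply; first by exists g.
exists (fun t => g (1 - t)); split; rewrite ?subr0 ?subrr// => t.
apply: continuous_comp; last exact: gC.
by apply: cvgB; [exact: cvg_cst|exact: cvg_id].
Qed.

End LocallyConnectedPaths.
(** * From paths to arcs *)

(** On a compact set [p] is a closed map, so it is a quotient map: the preimage of a closed set
    under [G] is the image under [p] of its preimage under [F]. *)
Lemma quotient_continuous (T U Y : topologicalType) (A : set T) (p : T -> U)
    (F : T -> Y) (G : U -> Y) :
  compact A -> {within A, continuous p} -> hausdorff_space U ->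
  {within A, continuous F} -> (forall t, A t -> G (p t) = F t) ->
  {within p @` A, continuous G}.
Proof.
move=> cA pC hU FC GF; apply/continuous_closedP => C clC.
have /continuous_closedP/(_ C clC)/closed_subspaceP[V clV VF] := FC.
apply/closed_subspaceP; exists (p @` (A `&` V)).
  apply: compact_closed => //; apply: continuous_compact.
    by apply: continuous_subspaceW pC => x [].
  exact: compact_closedI.
apply/seteqP; split => [_ [[t [At Vt] <-] _]|u [Gu [t At tu]]].
  have [Ft _] : (F @^-1` C `&` A) t by rewrite -VF.
  by split; [change (C (G (p t))); rewrite GF|exists t].
split; last by exists t.
exists t => //; split => //; have [] : (V `&` A) t => //.
rewrite VF; split => //; move: Gu; rewrite -tu => Gpt.
by change (C (F t)); rewrite -GF.
Qed.

Section RealLine.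
Context {R : realType}.
Implicit Types C W : set R.

Lemma closed_last C x y : closed C -> C y -> y <= x ->
  exists u, [/\ C u, y <= u, u <= x & forall v, u < v -> v <= x -> ~ C v].
Proof.
move=> clC Cy yx; pose A := C `&` [set u | u <= x].
have supA : has_sup A by split; [exists y|exists x => u []].
exists (sup A); split.
- apply: clC => B /nbhs_ballP[e e0 eB].
  have [a Aa ae] := sup_adherent e0 supA; exists a; split; first by case: Aa.
  apply: eB; rewrite /ball/= ger0_norm ?subr_ge0 ?ltrBlDl -?ltrBlDr//.
  exact: ub_le_sup supA.2 _ Aa.
- by apply: (ub_le_sup supA.2); split.
- by apply: ge_sup; [exact: supA.1|move=> u []].
- move=> v uv vx Cv; move: uv; rewrite ltNge => /negP; apply.
  by apply: (ub_le_sup supA.2); split.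
Qed.

Lemma closed_first C x y : closed C -> C y -> x <= y ->
  exists u, [/\ C u, x <= u, u <= y & forall v, x <= v -> v < u -> ~ C v].
Proof.
move=> clC Cy xy.
have clC' : closed (-%R @^-1` C).
  by apply: preimage_closed => // z _; exact: opp_continuous.
have [||u [Cu yu ux ulast]] := @closed_last _ (- x) (- y) clC'.
- by rewrite /preimage/= opprK.
- by rewrite lerN2.
exists (- u); split => //; [lra|lra|].
move=> v xv vu Cv; apply: (ulast (- v)); [lra|lra|].
by rewrite /preimage/= opprK.
Qed.

Lemma compact_chain_cover (K : set R) (F : set (set R)) :
  compact K -> F !=set0 -> total_on F subset -> (forall W, F W -> open W) ->
  K `<=` \bigcup_(W in F) W -> exists2 W, F W & K `<=` W.
Proof.
move=> /compact_near_coveringP cK [W0 FW0] tot oF KF.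
pose B (W : set R) := F `&` [set W' | W `<=` W'].
have FB : Filter (filter_from F B).
  apply: filter_from_filter; first by exists W0.
  move=> W1 W2 F1 F2; have [W12|W21] := tot _ _ F1 F2.
    exists W2 => // W [FW WW]; split; split => //; exact: subset_trans WW.
  exists W1 => // W [FW WW]; split; split => //; exact: subset_trans WW.
have [x Kx|W FW OK] := cK _ (filter_from F B) (fun W => W) FB.
  have [W FW Ox] := KF x Kx.
  exists (W, B W) => /=; last by move=> [y W'] [/= Oy [_ WW']]; exact: WW'.
  by split => /=; [exact: (open_nbhs_nbhs (conj (oF _ FW) Ox))|exists W].
by exists W => //; apply: OK; split.
Qed.

End RealLine.

(** * Cutting the loops out of a path *)

Section MonotonePath.
Context {R : realType} (X : metricType R) (f : R -> X).
Hypothesis fC : continuous f.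
Arguments fC : clear implicits.
Implicit Types W : set R.

(* [W] is a union of loops of [f] that can be cut out. *)
Definition erasable W := [/\ open W, W `<=` `]0, 1[ &
  forall s t, s < t -> ~ W s -> ~ W t -> `]s, t[ `<=` W -> f s = f t].

(** A gap ]s, t[ of the union need not be a gap of any member of the chain. But by compactness a
    slightly shorter segment lies in one member [W], and the ends of the gap of [W] around it are
    close to s and t. The values of [f] agree there, and continuity passes this to s and t. *)
Lemma erasable_chain (F : set (set R)) : F `<=` erasable ->
  total_on F subset -> erasable (\bigcup_(W in F) W).
Proof.
move=> FE tot; split; first by apply: bigcup_open => W /FE[].
  by apply: bigcup_sub => W /FE[].
move=> s t st Ws Wt stW; apply: contrapT => fst.
have d0 : 0 < mdist (f s) (f t) / 2.
  by rewrite divr_gt0// mdist_gt0; apply/eqP.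
have [d1 d10 h1] := (cvg_mdistE f s _).1 (fC s) _ d0.
have [d2 d20 h2] := (cvg_mdistE f t _).1 (fC t) _ d0.
pose d := Num.min (Num.min d1 d2) (t - s) / 4.
have [d_0 dd1 dd2 dst] : [/\ 0 < d, d < d1, d < d2 & d < (t - s) / 2].
  have m0 : 0 < Num.min (Num.min d1 d2) (t - s).
    by rewrite !lt_min d10 d20 subr_gt0.
  have : Num.min (Num.min d1 d2) (t - s) <= d1 by rewrite !ge_min lexx.
  have : Num.min (Num.min d1 d2) (t - s) <= d2 by rewrite !ge_min lexx !orbT.
  have : Num.min (Num.min d1 d2) (t - s) <= t - s by rewrite ge_min lexx orbT.
  by rewrite /d; split; lra.
pose K := `[s + d, t - d]%classic.
have F0 : F !=set0.
  have [|W FW _] := stW ((s + t) / 2); last by exists W.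
  by rewrite /= in_itv /=; apply/andP; split; lra.
have [||W FW KW] := @compact_chain_cover _ K F (@segment_compact _ _ _) F0 tot.
- by move=> W /FE[].
- move=> x; rewrite /K/= in_itv/= => /andP[x1 x2]; apply: stW.
  by rewrite /= in_itv/=; apply/andP; split; lra.
have [oW W01 Wf] := FE _ FW.
have nW x : ~ (\bigcup_(W in F) W) x -> ~ W x by move=> + Wx; apply; exists W.
have cW : closed (~` W) by apply: open_closedC.
have [|s' [Ws' ss' s'd s'W]] := @closed_last _ _ (s + d) s cW (nW _ Ws);
  first lra.
have [|t' [Wt' dt' t't t'W]] := @closed_first _ _ (t - d) t cW (nW _ Wt);
  first lra.
have KWE x : s + d <= x -> x <= t - d -> W x.
  by move=> h1' h2'; apply: KW; rewrite /K/= in_itv/= h1' h2'.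
have s'd' : s' < s + d.
  rewrite lt_neqAle s'd andbT; apply/eqP => s'E; apply: Ws'; apply: KWE; lra.
have fs't' : f s' = f t'.
  apply: Wf => //; first lra.
  move=> x; rewrite /= in_itv/= => /andP[x1 x2].
  have [xs|xs] := leP x (s + d); first by apply: contrapT; exact: s'W.
  have [xt|xt] := leP x (t - d); first by apply: KWE; lra.
  by apply: contrapT; apply: t'W => //; lra.
have m1 : mdist (f s) (f s') < mdist (f s) (f t) / 2.
  by apply: h1; rewrite distrC ger0_norm; lra.
have m2 : mdist (f t) (f t') < mdist (f s) (f t) / 2.
  by apply: h2; rewrite ger0_norm; lra.
rewrite fs't' in m1; have := metric_triangle (f s) (f t') (f t).
by rewrite [mdist (f t') _]metric_sym; lra.
Qed.

(** For a maximal erasable [W], the path is [f \o k], where [k] sends each gap of [W] to its left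
    end. A remaining loop would be a further interval to erase. *)
Lemma monotone_path : exists F : R -> X, [/\ continuous F, F 0 = f 0, F 1 = f 1,
  forall t, exists s, F t = f s &
  forall a t b, 0 <= a -> a <= t -> t <= b -> b <= 1 -> F a = F b -> F t = F a].
Proof.
have [W [[oW W01 Wf] Wmax]] := Zorn_bigcup erasable_chain.
have cW : closed (~` W) by apply: open_closedC.
have nW0 : ~ W 0 by move=> /W01; rewrite /= in_itv/= ltxx.
have nW1 : ~ W 1 by move=> /W01; rewrite /= in_itv/= ltxx andbF.
have /choice[k kP] : forall x, exists u, [/\ ~ W u, u <= x &
    forall v, u < v -> v <= x -> W v].
  (* The starting point outside [W] is 0 when x >= 0, and x itself when x < 0. *)
  move=> x; have [||u [Wu _ ux ulast]] := @closed_last _ _ x (Num.min x 0) cW.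
  - have [x0|x0] := ltP x 0 => //= /W01;
    rewrite /= in_itv/= ltNge => /andP[/negP].
    by rewrite ltW.
  - by rewrite ge_min lexx.
  exists u; split => // v uv vx; apply: contrapT; exact: ulast.
have kE x u : ~ W u -> u <= x -> (forall v, u < v -> v <= x -> W v) -> k x = u.
  move=> Wu ux ulast; have [Wk kx klast] := kP x.
  apply/eqP; rewrite eq_le; apply/andP; split; rewrite leNgt; apply/negP => h.
    by apply: Wk; apply: ulast.
  by apply: Wu; apply: klast.
have kid x : ~ W x -> k x = x.
  by move=> Wx; apply: kE => // v xv /(lt_le_trans xv); rewrite ltxx.
exists (f \o k); split.
- move=> t; have [Wt|Wt] := pselect (W t).
    have /nbhs_ballP[d d0 dW] := open_nbhs_nbhs (conj oW Wt).
    have [Wk kt klast] := kP t.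
    have ktd : k t <= t - d.
      rewrite leNgt; apply/negP => h; apply: Wk; apply: dW.
      by rewrite /ball/= ger0_norm; lra.
    apply/cvg_mdistE => e e0; exists d => // s /=;
      rewrite ltr_norml => /andP[s1 s2].
    rewrite (@kE s (k t)) ?mdistxx//; first lra.
    move=> v kv vs; have [vt|vt] := leP v t; first exact: klast.
    by apply: dW; rewrite /ball/= distrC ger0_norm; lra.
  apply/cvg_mdistE => e e0; rewrite /= (kid t Wt).
  have [d d0 h] := (cvg_mdistE f t _).1 (fC t) _ e0.
  exists d => // s; rewrite ltr_norml => /andP[s1 s2].
  have [Wk ks klast] := kP s.
  have [ktd|ktd] := ltP (t - d) (k s).
    by apply: h; rewrite ltr_norml; apply/andP; split; lra.
  have [Ws|Ws] := pselect (W s); last by rewrite kid//; apply: h;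
    rewrite ltr_norml; apply/andP; split; lra.
  have st : s < t.
    rewrite ltNge; apply/negP => ts; apply: Wt; apply: klast => //; lra.
  have [v [Wv sv vt vfirst]] := @closed_first _ _ s t cW Wt (ltW st).
  have -> : f (k s) = f v.
    apply: Wf => //; first lra.
    move=> x; rewrite /= in_itv/= => /andP[kx xv].
    have [xs|xs] := leP x s; first exact: klast.
    by apply: contrapT; apply: vfirst => //; lra.
  by apply: h; rewrite ltr_norml; apply/andP; split; lra.
- by rewrite /= kid.
- by rewrite /= kid.
- by move=> t; exists (k t).
- move=> a t b a0 at_ tb b1 /= fab.
  have [Wka ka kla] := kP a; have [Wkt kt klt] := kP t;
    have [Wkb kb klb] := kP b.
  have kat : k a <= k t.
    by rewrite leNgt; apply/negP => h; apply: Wka; apply: klt => //; lra.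
  have ktb : k t <= k b.
    by rewrite leNgt; apply/negP => h; apply: Wkt; apply: klb => //; lra.
  have ka0 : 0 <= k a.
    by rewrite leNgt; apply/negP => h; apply: nW0; apply: kla.
  have [kab|kab] := eqVneq (k a) (k b).
    by congr f; apply/eqP; rewrite eq_le kat andbT kab.
  have kab' : k a < k b by rewrite lt_neqAle kab; lra.
  have [E|ktE] := pselect (`]k a, k b[ `<=` W).
    have [->//|kakt] := eqVneq (k t) (k a).
    have [->//|ktkb] := eqVneq (k t) (k b).
    exfalso; apply: Wkt; apply: E; rewrite /= in_itv/= !lt_neqAle kat ktb ktkb.
    by rewrite eq_sym kakt.
  exfalso; apply: (Wmax (W `|` `]k a, k b[)).
    rewrite properEneq; split; last exact: subsetUl.
    apply/eqP => WE; apply: ktE; rewrite WE; exact: subsetUr.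
  split.
  + by apply: openU => //; exact: interval_open.
  + move=> x [/W01//|]; rewrite /= !in_itv/= => /andP[x1 x2].
    by apply/andP; split; lra.
  + move=> s u su /not_orP[Ws sab] /not_orP[Wu uab] suW.
    have [suW'|] := pselect (`]s, u[ `<=` W); first exact: Wf.
    move=> /existsNP[x /not_implyP[]]; rewrite /= in_itv/= => /andP[sx xu] nWx.
    have : (W `|` `]k a, k b[) x by apply: suW; rewrite /= in_itv/= sx xu.
    case=> //; rewrite /= in_itv/= => /andP[ax xb].
    (* The ends of ]k a, k b[ avoid the enlarged set, so they are not in ]s,
       u[; nor are s and u in ]k a, k b[. As x is common to both intervals, they coincide. *)
    have out y : ~ W y -> ~ (k a < y < k b) -> ~ (s < y < u).
      move=> Wy yab syu; have [//|] : (W `|` `]k a, k b[) y.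
        by apply: suW; rewrite /= in_itv.
      by rewrite /= in_itv.
    have := out _ Wka; have := out _ Wkb;
      rewrite !ltxx andbF/= => /(_ notF) ob /(_ notF) oa.
    have [sE uE] : s = k a /\ u = k b.
      move: sab uab; rewrite /= !in_itv/= => /negP sab /negP uab.
      by split; apply/eqP; lra.
    by rewrite sE uE.
Qed.

End MonotonePath.

(** * Reparametrizing a path without loops to an injective one *)

Section InjectivePath.
Context {R : realType} (X : metricType R) (F : R -> X).
Hypothesis FC : continuous F.
Arguments FC : clear implicits.

Let d1 (x y : X) : R := Num.min 1 (mdist x y).

(** The largest distance from [F q] reached between times q and t. It vanishes for t <= q, is
    continuous and nondecreasing in t, and is constant on intervals where [F] is. Capping the
    distance at 1 makes the sum over all rational q converge. *)
Let excursion (q t : R) : R :=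
  sup [set d1 (F q) (F s) | s in [set s | q <= s <= Num.max q t]].

Let d1_ge0 x y : 0 <= d1 x y.
Proof. by rewrite le_min ler01 mdist_ge0. Qed.

Let d1_triangle x y z : d1 x z <= d1 x y + mdist y z.
Proof.
have := metric_triangle x y z; have := mdist_ge0 y z.
by rewrite /d1 !minEle; do 2 case: ifP => //; lra.
Qed.

Let excursion_ub q t s : q <= s -> s <= Num.max q t ->
  d1 (F q) (F s) <= excursion q t.
Proof.
move=> qs st; apply: ub_le_sup; last by exists s => //=; rewrite qs.
by exists 1 => _ [u _ <-]; rewrite ge_min lexx.
Qed.

Let excursion_le q t z :
  (forall s, q <= s -> s <= Num.max q t -> d1 (F q) (F s) <= z) ->
  excursion q t <= z.
Proof.
move=> h; apply: ge_sup => [|_ [s /andP[qs st] <-]]; last exact: h.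
by exists (d1 (F q) (F q)), q => //=; rewrite lexx le_max lexx.
Qed.

Let excursion_ge0 q t : 0 <= excursion q t.
Proof.
by rewrite (le_trans (d1_ge0 (F q) (F q)))// excursion_ub// le_max lexx.
Qed.

Let excursion_le1 q t : excursion q t <= 1.
Proof. by apply: excursion_le => s _ _; rewrite ge_min lexx. Qed.

Let excursion_homo q u v : u <= v -> excursion q u <= excursion q v.
Proof.
move=> uv; apply: excursion_le => s qs su; apply: excursion_ub => //.
by rewrite (le_trans su)// ge_max !le_max lexx uv orbT.
Qed.

Let excursion_const q u v : u <= v ->
  (forall s, u <= s -> s <= v -> F s = F u) -> excursion q u = excursion q v.
Proof.
move=> uv Fuv; apply/eqP; rewrite eq_le excursion_homo//=.
apply: excursion_le => s qs sv; have [su|us] := leP s (Num.max q u).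
  exact: excursion_ub.
move: us; rewrite gt_max => /andP[qs' us].
have sv' : s <= v by move: sv; rewrite le_max leNgt qs'.
rewrite (Fuv s (ltW us) sv'); have [qu|uq] := leP q u.
  by apply: excursion_ub => //; rewrite le_max lexx orbT.
have -> : F u = F q by rewrite (Fuv q (ltW uq))// (le_trans qs).
by apply: excursion_ub => //; rewrite le_max lexx.
Qed.

Let excursion_continuous q : continuous (excursion q).
Proof.
move=> t; apply/cvgrPdist_lt => e e0.
have e20 : 0 < e / 4 by rewrite divr_gt0.
have [d d0 h] := (cvg_mdistE F t _).1 (FC t) _ e20.
have near u v : `|t - u| < d -> `|t - v| < d -> u <= v ->
    excursion q v <= excursion q u + e / 2.
  move=> tu tv uv; apply: excursion_le => s qs sv.
  have [su|us] := leP s (Num.max q u).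
    by have := excursion_ub qs su; lra.
  have qu : d1 (F q) (F (Num.max q u)) <= excursion q u.
    by apply: excursion_ub => //; rewrite le_max lexx.
  apply: (le_trans (d1_triangle _ (F (Num.max q u)) _)); apply: lerD => //.
  move: us; rewrite gt_max => /andP[qs' us].
  have sv' : s <= v by move: sv; rewrite le_max leNgt qs'.
  have dt w : u <= w -> w <= v -> mdist (F t) (F w) < e / 4.
    move=> uw wv; apply: h; move: tu tv;
      rewrite !ltr_norml => /andP[? ?] /andP[? ?].
    by apply/andP; split; lra.
  have := dt s (ltW us) sv'.
  have : mdist (F t) (F (Num.max q u)) < e / 4.
    by apply: dt; rewrite ?le_max ?lexx ?orbT// ge_max uv (le_trans qs).
  have := metric_triangle (F (Num.max q u)) (F t) (F s).
  by rewrite [mdist _ (F t)]metric_sym; lra.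
apply/nbhs_ballP; exists d => // s; rewrite /ball/= => ts.
have tt : `|t - t| < d by rewrite subrr normr0.
have [st|st] := leP t s.
  have := near _ _ tt ts st; have := excursion_homo q st.
  by rewrite ltr_norml => ? ?; apply/andP; split; lra.
have := near _ _ ts tt (ltW st); have := excursion_homo q (ltW st).
by rewrite ltr_norml => ? ?; apply/andP; split; lra.
Qed.

Let rational (n : nat) : R := if unpickle n is Some r then ratr (r : rat) else
  0.

Let rational_dense a b : a < b -> exists n, a < rational n < b.
Proof.
move=> /rat_in_itvoo[r]; rewrite in_itv/= => ab.
by exists (pickle r); rewrite /rational pickleK.
Qed.

(** Partial sums of the excursions from an enumeration of the rationals with weights 1/2, 1/4, and
    so on. The limit [phi] is a clock that advances exactly when [F] moves. *)
Let partial := fix partial N t : R :=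
  if N is N'.+1 then partial N' t + excursion (rational N') t / 2 ^+ N else 0.

Let partial_continuous N : continuous (partial N).
Proof.
elim: N => [|N IH]; first exact: cst_continuous.
move=> t; apply: cvgD; first exact: IH.
by apply: cvgMl; exact: excursion_continuous.
Qed.

Let partial_tail N M t : partial N t <= partial (N + M) t /\
  partial (N + M) t <= partial N t + (2 ^+ N)^-1 - (2 ^+ (N + M))^-1.
Proof.
elim: M => [|M [IH1 IH2]]; first by rewrite addn0; lra.
rewrite addnS /= exprS invfM.
have p0 : 0 < (2 ^+ (N + M))^-1 :> R by rewrite invr_gt0 exprn_gt0.
have := excursion_ge0 (rational (N + M)) t.
have := excursion_le1 (rational (N + M)) t.
by set x := excursion _ _ => x1 x0; split; nra.
Qed.

Let phi t := sup (range (partial^~ t)).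

Let partial_sup t : has_sup (range (partial^~ t)).
Proof.
split; first by exists (partial 0 t), 0%N.
exists 1 => _ [N _ <-]; have [_] := partial_tail 0 N t.
have : 0 < (2 ^+ N)^-1 :> R by rewrite invr_gt0 exprn_gt0.
by rewrite add0n expr0 invr1 /=; lra.
Qed.

Let partial_le N t : partial N t <= phi t.
Proof. by apply: (ub_le_sup (partial_sup t).2); exists N. Qed.

Let phi_le N t : phi t <= partial N t + (2 ^+ N)^-1.
Proof.
apply: ge_sup; first exact: (partial_sup t).1.
move=> _ [M _ <-]; have p0 k : 0 < (2 ^+ k)^-1 :> R by rewrite invr_gt0
  exprn_gt0.
have [NM|MN] := leqP N M.
  by have [_] := partial_tail N (M - N) t; rewrite subnKC// => h; have := p0 M;
    lra.
have [+ _] := partial_tail M (N - M) t; rewrite subnKC ?(ltnW MN)//.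
by have := p0 N; lra.
Qed.

Let phi_continuous : continuous phi.
Proof.
move=> t; apply/cvgrPdist_lt => e e0.
have [N Ne] : exists N, (2 ^+ N)^-1 < e / 4.
  have := truncnS_gt (4 / e); set k := (Num.truncn _).+1 => ek.
  have k2 : k%:R < 2 ^+ k :> R by rewrite -natrX ltr_nat ltn_expl.
  exists k; rewrite -[e / 4]invrK ltf_pV2 ?posrE ?invr_gt0 ?exprn_gt0
    ?divr_gt0//.
  by rewrite invf_div (lt_trans ek).
have e20 : 0 < e / 4 by rewrite divr_gt0.
have /cvgrPdist_lt/(_ _ e20) := @partial_continuous N t.
apply: filterS => s; rewrite !ltr_norml => /andP[h1 h2].
have := partial_le N t; have := phi_le N t; have := partial_le N s;
  have := phi_le N s.
by move=> ? ? ? ?; apply/andP; split; lra.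
Qed.

Let partial_homo N u v : u <= v -> partial N u <= partial N v.
Proof.
move=> uv; elim: N => //= N IH; apply: lerD => //.
by rewrite ler_pM2r ?invr_gt0 ?exprn_gt0// excursion_homo.
Qed.

Let phi_homo u v : u <= v -> phi u <= phi v.
Proof.
move=> uv; apply: ge_sup; first exact: (partial_sup u).1.
by move=> _ [M _ <-]; rewrite (le_trans _ (partial_le M v))// partial_homo.
Qed.

(** A rational q just after u has [F q] different from [F v]. The excursion from q is 0 at u,
    because q has not yet come, and positive at v. *)
Let phi_lt u v : u < v -> F u <> F v -> phi u < phi v.
Proof.
move=> uv Fuv.
have e0 : 0 < mdist (F u) (F v) by rewrite mdist_gt0; apply/eqP.
have [d d0 h] := (cvg_mdistE F u _).1 (FC u) _ e0.
have [|n /andP[un nv]] := @rational_dense u (Num.min v (u + d)).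
  by rewrite lt_min uv ltrDl.
move: nv; rewrite lt_min => /andP[nv nd].
have Fnv : F (rational n) <> F v.
  move=> Fn; have : mdist (F u) (F (rational n)) < mdist (F u) (F v).
    by apply: h; rewrite distrC ger0_norm; lra.
  by rewrite Fn ltxx.
have xu : excursion (rational n) u = 0.
  apply/eqP; rewrite eq_le excursion_ge0 andbT; apply: excursion_le => s ns.
  rewrite maxEle; case: ifP => [|_ sn]; first lra.
  have -> : s = rational n by apply/eqP; lra.
  by rewrite /d1 mdistxx ge_min lexx orbT.
have xv : 0 < excursion (rational n) v.
  apply: (@lt_le_trans _ _ (d1 (F (rational n)) (F v))).
    by rewrite lt_min ltr01 mdist_gt0; apply/eqP.
  by apply: excursion_ub; [exact: ltW|rewrite le_max lexx orbT].
have step N : (n < N)%N ->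
    partial N u + excursion (rational n) v / 2 ^+ n.+1 <= partial N v.
  elim: N => // N IH; rewrite ltnS leq_eqVlt => /predU1P[<-|nN] /=.
    by rewrite xu mul0r addr0; apply: lerD => //; exact: partial_homo (ltW uv).
  rewrite addrAC; apply: lerD; first exact: IH.
  by rewrite ler_pM2r ?invr_gt0 ?exprn_gt0// excursion_homo// ltW.
pose z := excursion (rational n) v / 2 ^+ n.+1.
have z0 : 0 < z by rewrite divr_gt0// exprn_gt0.
suff : phi u <= phi v - z by lra.
apply: ge_sup; first exact: (partial_sup u).1.
move=> _ [M _ <-]; have [nM|Mn] := ltnP n M.
  by have := step M nM; have := partial_le M v; rewrite -/z; lra.
have [+ _] := partial_tail M (n.+1 - M) u; rewrite subnKC ?(leq_trans Mn)//.
by have := step n.+1 (leqnn _); have := partial_le n.+1 v; rewrite -/z; lra.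
Qed.

Let phi_const u v : u <= v ->
  (forall s, u <= s -> s <= v -> F s = F u) -> phi u = phi v.
Proof.
move=> uv Fuv; suff E : partial^~ u = partial^~ v by rewrite /phi E.
by apply/funext; elim=> //= N ->; rewrite (excursion_const _ uv Fuv).
Qed.

(** By [phi_lt] and [phi_const], the normalized clock [p] has the same fibres on [0, 1] as [F].
    Hence [F] factors through [p] injectively, and the factor is continuous because [p] is a
    quotient map. *)
Lemma injective_path : F 0 <> F 1 ->
  (forall a t b, 0 <= a -> a <= t -> t <= b -> b <= 1 -> F a = F b -> F t = F
    a) ->
  exists G : R -> X, [/\ {within `[0, 1], continuous G}, set_inj `[0, 1] G,
    G 0 = F 0, G 1 = F 1 & forall u, 0 <= u <= 1 -> exists t, G u = F t].
Proof.
move=> F01 Fmono; have phi01 := phi_lt ltr01 F01.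
pose L := phi 1 - phi 0; have L0 : 0 < L by rewrite subr_gt0.
pose p t := (phi t - phi 0) / L.
have p0 : p 0 = 0 by rewrite /p subrr mul0r.
have p1 : p 1 = 1 by rewrite /p divff// gt_eqF.
have pC : continuous p.
  move=> t; apply: cvgMl; apply: cvgB; last exact: cvg_cst.
  exact: phi_continuous.
have phiF a b : 0 <= a -> a <= b -> b <= 1 -> (p a = p b <-> F a = F b).
  move=> a0 ab b1; split=> [pab|Fab].
    apply: contrapT => Fab; have [abE|ab'] := eqVneq a b;
      first by rewrite abE in Fab.
    have ltab : a < b by rewrite lt_neqAle ab' ab.
    have pab' := phi_lt ltab Fab.
    by move: pab; rewrite /p => /(mulIf (lt0r_neq0 _));
      rewrite invr_gt0 => /(_ L0); lra.
  congr ((_ - _) / _); apply: phi_const => // s as_ sb.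
  exact: (Fmono a s b).
have pF a b : 0 <= a <= 1 -> 0 <= b <= 1 -> (p a = p b <-> F a = F b).
  move=> /andP[a0 a1] /andP[b0 b1]; have [ab|ba] := leP a b; first exact: phiF.
  by split=> /esym/(phiF b a b0 (ltW ba) a1)/esym.
have /choice[tau tauP] : forall u, exists t, 0 <= u <= 1 -> 0 <= t <= 1 /\ p t
  = u.
  move=> u; have [u01|u01] := pselect (0 <= u <= 1); last by exists 0.
  have [| |t + pt] := @IVT _ p 0 1 u ler01.
  - exact: continuous_subspaceT.
  - by rewrite p0 p1 minEle maxEle ler01.
  by rewrite in_itv/= => t01; exists t.
have p01 t : 0 <= t <= 1 -> 0 <= p t <= 1.
  move=> /andP[t0 t1]; rewrite /p; apply/andP; split.
    by rewrite divr_ge0 ?(ltW L0)// subr_ge0 phi_homo.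
  by rewrite ler_pdivrMr// mul1r lerB// phi_homo.
have GF t : 0 <= t <= 1 -> F (tau (p t)) = F t.
  by move=> t01; have [h1 h2] := tauP _ (p01 _ t01); apply/pF.
have pim : p @` `[0, 1] = `[0, 1]%classic.
  apply/seteqP; split => [_ [t + <-]|u]; rewrite /= !in_itv/=; first exact: p01.
  by move=> /tauP[t01 pt]; exists (tau u) => //=; rewrite in_itv.
exists (F \o tau); split.
- rewrite -pim; apply: (@quotient_continuous _ _ _ _ p F).
  + exact: segment_compact.
  + exact: continuous_subspaceT.
  + exact: Rhausdorff.
  + exact: continuous_subspaceT.
  + by move=> t; rewrite /= in_itv/= => /GF.
- move=> u v; rewrite !inE /= !in_itv/= => /tauP[tu pu] /tauP[tv pv].
  by move=> /(pF _ _ tu tv); rewrite pu pv.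
- by rewrite /= -{1}p0 GF// lexx ler01.
- by rewrite /= -{1}p1 GF// lexx ler01.
- by move=> u _; exists (tau u).
Qed.

End InjectivePath.
(** * Interior points of arcs separate the endpoints *)

Lemma fst_continuous (T U : topologicalType) : continuous (@fst T U).
Proof. by move=> p; exact: cvg_fst. Qed.

Lemma snd_continuous (T U : topologicalType) : continuous (@snd T U).
Proof. by move=> p; exact: cvg_snd. Qed.

Lemma within_comp_continuous (T U Y : topologicalType) (A : set U) (k : T -> U)
    (f : U -> Y) : continuous k -> (forall t, A (k t)) ->
  {within A, continuous f} -> continuous (f \o k).
Proof.
move=> kC kA /subspace_continuousP fC t W /(fC _ (kA t)) fW.
by move: (kC t _ fW); rewrite /nbhs/=; apply: filterS => s /(_ (kA s)).
Qed.

Lemma open_component (X : topologicalType) (U : set X) x :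
  locally_connected X -> open U -> open (connected_component U x).
Proof.
move=> lc oU; rewrite openE => y Uxy.
have Uy := connected_component_sub Uxy.
have [V [oV Vy cV VU]] := lc _ _ (open_nbhs_nbhs (conj oU Uy)).
apply: filterS (open_nbhs_nbhs (conj oV Vy)) => w Vw.
by apply: (connected_component_trans Uxy); exists V.
Qed.

Section Circle.
Context {R : realType}.

(** The retraction of the line onto [0, 1]: composing with it turns continuity within [0, 1] into
    continuity everywhere. *)
Definition clamp (t : R) := Num.max 0 (Num.min 1 t).

Lemma clamp_itv t : `[0, 1]%classic (clamp t).
Proof.
by rewrite /= in_itv/= /clamp le_max lexx/= ge_max ler01 ge_min lexx.
Qed.

Lemma clamp_id t : 0 <= t <= 1 -> clamp t = t.
Proof. by move=> /andP[t0 t1]; rewrite /clamp (min_idPr t1) (max_idPr t0). Qed.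

Lemma clamp_continuous : continuous clamp.
Proof.
move=> t; apply/cvgrPdist_lt => e e0; apply/nbhs_ballP; exists e => //= s.
rewrite /ball/=; apply: le_lt_trans; rewrite /clamp !maxEle !minEle.
by rewrite ler_norml; have := ler_norm (t - s); have := ler_norm (s - t);
  rewrite distrC; do 4 case: ifP; lra.
Qed.

Lemma closed_circle : closed (@circle R).
Proof.
have -> : @circle R = (fun p : R * R => p.1 ^+ 2 + p.2 ^+ 2) @^-1` [set 1] by
  [].
apply: preimage_closed; last exact: closed_eq.
move=> p _; apply: cvgD; apply: (@cvg_comp _ _ _ _ (fun x : R => x ^+ 2)).
- exact: fst_continuous.
- exact: exprn_continuous.
- exact: snd_continuous.
- exact: exprn_continuous.
Qed.

Lemma compact_circle : compact (@circle R).
Proof.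
have -> : @circle R = (`[-1, 1] `*` `[-1, 1]) `&` circle.
  apply/esym/setIidPr => p; rewrite /circle/= => p1.
  have b (x y : R) : x ^+ 2 + y ^+ 2 = 1 -> -1 <= x <= 1.
    move=> xy; rewrite -ler_norml -(@ler_pXn2r _ 2)// ?nnegrE//.
    by rewrite expr1n real_normK ?num_real// -xy lerDl sqr_ge0.
  split; rewrite /= in_itv/=; first exact: b p1.
  by apply: (b _ p.1); rewrite addrC.
by apply: compact_closedI;
  [apply: compact_setX; exact: segment_compact|exact: closed_circle].
Qed.

Variable X : metricType R.

(** The upper half of the circle is projected to [0, 1] and followed by [f], the lower half by [g].
    The two points on the axis are given to [f], so disjointness is asked only of the interior of
    [g]. *)
Lemma simple_closed_curve_glue (f g : R -> X) : continuous f -> continuous g ->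
  set_inj `[0, 1] f -> set_inj `[0, 1] g -> f 0 = g 0 -> f 1 = g 1 ->
  (forall s t, 0 <= s <= 1 -> 0 < t < 1 -> f s <> g t) ->
  exists C : set X, simple_closed_curve C.
Proof.
move=> fC gC fI gI fg0 fg1 fg.
pose k (p : R * R) := (p.1 + 1) / 2.
have kC : continuous k.
  move=> p; apply: cvgMl; apply: cvgD; [exact: fst_continuous|exact: cvg_cst].
pose h (p : R * R) := if 0 <= p.2 then f (k p) else g (k p).
have circ p : circle p -> `[0, 1]%classic (k p).
  move=> p1; have : `|p.1| <= 1.
    rewrite -(@ler_pXn2r _ 2)// ?nnegrE//.
    by rewrite expr1n real_normK ?num_real// -p1 lerDl sqr_ge0.
  by rewrite ler_norml /= in_itv/= /k => ?; apply/andP; split; lra.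
have circ0 p : circle p -> p.2 = 0 -> k p = 0 \/ k p = 1.
  rewrite /circle/= => p1 p2; move: p1; rewrite p2 expr0n/= addr0 => /eqP.
  by rewrite sqrf_eq1 => /orP[|] /eqP p1; rewrite /k p1; [right|left]; lra.
have circlt p : circle p -> p.2 < 0 -> 0 < k p < 1.
  move=> p1 p2; have : `|p.1| < 1.
    rewrite -(@ltr_pXn2r _ 2)// ?nnegrE//.
    by rewrite expr1n real_normK ?num_real// -p1 ltrDl lt0r sqr_ge0 sqrf_eq0
      lt_eqF.
  by rewrite ltr_norml /k => ?; apply/andP; split; lra.
have hC : {within circle, continuous h}.
  have -> : @circle R = (circle `&` snd @^-1` [set y | 0 <= y]) `|`
      (circle `&` snd @^-1` [set y | y <= 0]).
    rewrite -setIUr; apply/esym/setIidPl => p _ /=; exact/orP/le_total.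
  have cc := closed_circle.
  apply: withinU_continuous.
  - apply: closedI => //; apply: preimage_closed; last exact: closed_ge.
    by move=> p _; exact: snd_continuous.
  - apply: closedI => //; apply: preimage_closed; last exact: closed_le.
    by move=> p _; exact: snd_continuous.
  - apply: (@subspace_eq_continuous _ _ _ (f \o k)).
      move=> p; rewrite inE => -[_ /= p2].
      by change (f (k p) = h p); rewrite /h p2.
    by apply: continuous_subspaceT => p; apply: continuous_comp;
      [exact: kC|exact: fC].
  - apply: (@subspace_eq_continuous _ _ _ (g \o k)).
      move=> p; rewrite inE => -[/circ0 p1 /= p2]; change (g (k p) = h p).
      rewrite /h; case: leP => // p20; move: p1.
      by case=> [|->|->]//; apply/eqP; rewrite eq_le p2 p20.
    by apply: continuous_subspaceT => p; apply: continuous_comp;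
      [exact: kC|exact: gC].
have kp p q : circle p -> circle q -> k p = k q -> p.1 = q.1 /\ p.2 ^+ 2 = q.2
  ^+ 2.
  rewrite /circle/= /k => p1 q1 kpq; have pq : p.1 = q.1 by lra.
  by split => //; rewrite pq in p1; lra.
have fgk p q : circle p -> circle q -> 0 <= p.2 -> q.2 < 0 -> f (k p) <> g (k
  q).
  by move=> cp cq _ q2; apply: fg; [exact: circ|exact: circlt].
have hI : set_inj circle h.
  move=> p q /[!inE] cp cq; rewrite /h.
  case: leP => p2; case: leP => q2.
  - move=> /fI; rewrite !inE => /(_ (circ _ cp) (circ _ cq)) /(kp _ _ cp cq)[e1
    e2].
    case: p q e1 e2 p2 q2 {cp cq} => p1 p2 [q1 q2] /= -> e2 p20 q20; congr pair.
    by apply/eqP; rewrite -(@eqrXn2 _ 2)//; apply/eqP.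
  - by move=> /(fgk _ _ cp cq p2 q2).
  - by move=> /esym/(fgk _ _ cq cp q2 p2).
  - move=> /gI; rewrite !inE => /(_ (circ _ cp) (circ _ cq)) /(kp _ _ cp cq)[e1
    e2].
    case: p q e1 e2 p2 q2 {cp cq} => p1 p2 [q1 q2] /= -> e2 p20 q20; congr pair.
    apply: oppr_inj; apply/eqP; rewrite -(@eqrXn2 _ 2)// ?oppr_ge0 ?ltW//.
    by rewrite !sqrrN; apply/eqP.
have /choice[j jP] : forall x, exists p, (h @` circle) x -> circle p /\ h p = x.
  move=> x; have [[p cp hp]|hx] := pselect ((h @` circle) x); first by exists p.
  by exists (0, 0).
have jh p : circle p -> j (h p) = p.
  move=> cp; have [|cj hj] := jP (h p); first by exists p.
  by apply: hI; rewrite ?inE.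
exists (h @` circle), h; split => //; first by split => // x [p cp <-];
  exists p.
exists j; first by move=> p; rewrite inE; exact: jh.
(* The inverse of a continuous injection of a compact set is continuous: the quotient lemma with the
   identity as the map to factor. *)
apply: (@quotient_continuous _ _ _ _ h id).
- exact: compact_circle.
- exact: hC.
- exact: metric_hausdorff.
- by apply: continuous_subspaceT => p; exact: cvg_id.
- exact: jh.
Qed.

End Circle.
Section Arcs.
Context {R : realType} (X : metricType R).
Implicit Types (x y z : X) (A : set X).

Lemma set_homeo_clamp A (f : R -> X) : set_homeo (`[0, 1] : set R) A f ->
  [/\ continuous (f \o clamp), set_inj `[0, 1] (f \o clamp) & A = f @` `[0, 1]].
Proof.
move=> [[fA fI fS] fC _]; split.
- by apply: within_comp_continuous fC;
  [exact: clamp_continuous|exact: clamp_itv].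
- move=> s t /[!inE] s01 t01 /=.
  by rewrite !clamp_id; [move=> /fI; rewrite !inE; apply|
     by move: t01; rewrite /= in_itv|by move: s01; rewrite /= in_itv].
- by apply/seteqP; split => // _ [t t01 <-]; exact: fA.
Qed.

Lemma affine_itv (a b w : R) : a < b -> 0 <= w <= 1 -> a <= a + (b - a) * w <=
  b.
Proof. by move=> ab /andP[w0 w1]; apply/andP; split; nra. Qed.

Lemma affine_itvoo (a b w : R) : a < b -> 0 < w < 1 -> a < a + (b - a) * w < b.
Proof. by move=> ab /andP[w0 w1]; apply/andP; split; nra. Qed.

(* The last time [g] is on the part of [f] before [r], and the first later time
   it is on the part after [r], cut out an arc of [g] closing up with [f]. *)
Lemma crossing_arcs_curve (f g : R -> X) r : continuous f -> continuous g ->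
  set_inj `[0, 1] f -> set_inj `[0, 1] g -> f 0 = g 0 -> f 1 = g 1 ->
  0 < r < 1 -> (forall t, 0 <= t <= 1 -> g t <> f r) ->
  exists C : set X, simple_closed_curve C.
Proof.
move=> fC gC fI gI fg0 fg1 /andP[r0 r1] gr.
have fIE a b : 0 <= a <= 1 -> 0 <= b <= 1 -> f a = f b -> a = b.
  by move=> a1 b1; apply: fI; rewrite inE/= in_itv.
have gIE a b : 0 <= a <= 1 -> 0 <= b <= 1 -> g a = g b -> a = b.
  by move=> a1 b1; apply: gI; rewrite inE/= in_itv.
have cl a b : closed (`[0, 1] `&` g @^-1` (f @` `[a, b])).
  apply: closedI; first exact: itv_closed.
  apply: preimage_closed; first by move=> ? _; exact: gC.
  apply: compact_closed; first exact: metric_hausdorff.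
  by apply: continuous_compact;
    [exact: continuous_subspaceT|exact: segment_compact].
have [|s [[]]] := closed_last (cl 0 r) _ ler01.
  split; first by rewrite /= in_itv/= lexx ler01.
  by exists 0 => //; rewrite /= in_itv/= lexx ltW.
rewrite /= in_itv/= => /andP[s0 s1] [u + fus] _ _ slast.
rewrite in_itv/= => /andP[u0 ur].
have [|t [[]]] := @closed_first _ _ s 1 (cl r 1) _ s1.
  split; first by rewrite /= in_itv/= lexx ler01.
  by exists 1 => //; rewrite /= in_itv/= lexx ltW.
rewrite /= in_itv/= => /andP[t0 t1] [v + fvt] st _ tfirst.
rewrite in_itv/= => /andP[rv v1].
have ur' : u < r.
  rewrite lt_neqAle ur andbT; apply/eqP => ur'.
  by apply: (gr s); rewrite ?s0// -fus ur'.
have rv' : r < v.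
  rewrite lt_neqAle rv andbT; apply/eqP => rv'.
  by apply: (gr t); rewrite ?t0// -fvt rv'.
have st' : s < t.
  rewrite lt_neqAle st andbT; apply/eqP => sE; subst t.
  have : u = v by apply: fIE; [rewrite u0; lra|rewrite v1; lra|rewrite fus].
  lra.
apply: (@simple_closed_curve_glue _ _ (fun w => f (u + (v - u) * w))
   (fun w => g (s + (t - s) * w))).
- move=> w; apply: continuous_comp; last exact: fC.
  by apply: cvgD; [exact: cvg_cst|exact: mulrl_continuous].
- move=> w; apply: continuous_comp; last exact: gC.
  by apply: cvgD; [exact: cvg_cst|exact: mulrl_continuous].
- move=> a b; rewrite !inE /= !in_itv/= => a01 b01 /fIE fab.
  have uv := lt_trans ur' rv'.
  have := affine_itv uv a01; have := affine_itv uv b01 => ? ?.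
  have : u + (v - u) * a = u + (v - u) * b by apply: fab; lra.
  by move=> /addrI/mulfI; apply; rewrite subr_eq0 gt_eqF.
- move=> a b; rewrite !inE /= !in_itv/= => a01 b01 /gIE gab.
  have := affine_itv st' a01; have := affine_itv st' b01 => ? ?.
  have : s + (t - s) * a = s + (t - s) * b by apply: gab; lra.
  by move=> /addrI/mulfI; apply; rewrite subr_eq0 gt_eqF.
- by rewrite !mulr0 !addr0.
- by rewrite !mulr1 !subrKC.
- move=> a b a01 b01; set fa := u + _; set gb := s + _ => fg.
  have /andP[fa0 fa1] := affine_itv (lt_trans ur' rv') a01.
  have /andP[gb1 gb2] := affine_itvoo st' b01.
  rewrite -/fa -/gb in fa0 fa1 gb1 gb2.
  have gb01 : `[0, 1]%classic gb by rewrite /= in_itv/=; apply/andP; split; lra.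
  have [far|rfa] := leP fa r.
    apply: (slast gb) => //; first lra.
    by split => //; exists fa => //; rewrite /= in_itv/= far (le_trans u0).
  apply: (tfirst gb) => //; first lra.
  by split => //; exists fa => //; rewrite /= in_itv/= (ltW rfa) (le_trans fa1).
Qed.

Lemma arc_between_separates x y z A : dendrite X -> arc_between x y A -> A z ->
  z <> x -> z <> y -> comp_at z x <> comp_at z y.
Proof.
move=> [_ cX _ lc noC] [f [fA fx fy]] Az zx zy Uxy; apply: noC.
have [fC fI AE] := set_homeo_clamp fA.
move: Az; rewrite AE => -[r]; rewrite /= in_itv/= => /andP[r0 r1] fr.
pose U := comp_at z x.
have oU : open U.
  apply: open_component => //; apply: closed_openC.
  exact: accessible_closed_set1 (hausdorff_accessible (@metric_hausdorff _ X))
    _.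
have cU : connected U by exact: component_connected.
have Ux : U x by apply: connected_component_refl => /esym.
have Uy : U y by rewrite /U Uxy; apply: connected_component_refl => /esym.
have [g [gC gx gy gU]] := open_connected_path lc cX oU cU Ux Uy.
have f0 : (f \o clamp) 0 = x by rewrite /= clamp_id// lexx ler01.
have f1 : (f \o clamp) 1 = y by rewrite /= clamp_id// lexx ler01.
have fIE a b : 0 <= a <= 1 -> 0 <= b <= 1 -> (f \o clamp) a = (f \o clamp) b ->
  a = b.
  by move=> a1 b1; apply: fI; rewrite inE/= in_itv.
have xy : g 0 <> g 1.
  rewrite gx gy -f0 -f1 => /fIE; rewrite !lexx ler01 => /(_ isT isT)/eqP.
  by rewrite eq_sym oner_eq0.
have [F [FC F0 F1 Fg Fmono]] := monotone_path gC.
rewrite -F0 -F1 in xy.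
have [G [GC GI G0 G1 GF]] := injective_path FC xy Fmono.
have G01 t : 0 <= t <= 1 -> (G \o clamp) t = G t.
  by move=> t01; rewrite /= clamp_id.
have fr' : (f \o clamp) r = z by rewrite /= clamp_id// r0 r1.
apply: (@crossing_arcs_curve (f \o clamp) (G \o clamp) r) => //.
- by apply: within_comp_continuous GC;
  [exact: clamp_continuous|exact: clamp_itv].
- move=> s t /[!inE]; rewrite /= !in_itv/= => s01 t01;
  rewrite !clamp_id// => /GI.
  by rewrite !inE /= !in_itv/=; apply.
- by rewrite G01 ?lexx ?ler01// f0 G0 F0.
- by rewrite G01 ?lexx ?ler01// f1 G1 F1.
- apply/andP; split; rewrite lt_neqAle ?r0 ?r1 andbT; apply/eqP => rE.
    by apply: zx; rewrite -fr' -rE f0.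
  by apply: zy; rewrite -fr' rE f1.
- move=> t t01; rewrite G01// fr'; have [s ->] := GF t t01.
  have [w ->] := Fg s; exact: (connected_component_sub (gU w)).
Qed.

End Arcs.
(** * Back-and-forth in colored trees *)

Lemma seq_minimal (T : eqType) (l : seq T) (P : T -> Prop) (r : T -> T -> Prop)
  :
  (forall x, x \in l -> ~ r x x) ->
  (forall x y z, x \in l -> y \in l -> z \in l -> r x y -> r y z -> r x z) ->
  (exists2 x, x \in l & P x) ->
  exists x, [/\ x \in l, P x & forall y, y \in l -> P y -> ~ r y x].
Proof.
elim: l => [|a l IH] irr tr [x xal Px]; first by [].
have sub y : y \in l -> y \in a :: l by rewrite inE => ->; rewrite orbT.
have [[y yl Py]|nl] := pselect (exists2 y, y \in l & P y); last first.
  exists x; split => // y; rewrite inE => /predU1P[->|yl] Py; last by case: nl;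
    exists y.
  move: xal; rewrite inE => /predU1P[->|xl]; last by case: nl; exists x.
  by apply: irr; rewrite inE eqxx.
have [||m [ml Pm mmin]] := IH _ _ (ex_intro2 _ _ y yl Py).
- by move=> z zl; apply: irr; exact: sub.
- by move=> u v w ul vl wl; apply: tr; exact: sub.
have [[Pa ram]|h] := pselect (P a /\ r a m); last first.
  exists m; split => //; first exact: sub.
  by move=> z; rewrite inE => /predU1P[->|zl] Pz; [move=> raz;
    apply: h|exact: mmin].
have ain : a \in a :: l by rewrite inE eqxx.
exists a; split => // z; rewrite inE => /predU1P[->|zl] Pz; first exact: irr.
by move=> rza; apply: (mmin z zl Pz); apply: tr ram => //; exact: sub.
Qed.

Section BackAndForth.
Context {T : eqType} {K : Type}.
Implicit Types (B : set T) (col : T -> T -> K) (E : seq (T * T)).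

(** Stands for m lying on the closed arc between x and y, expressed by colors only. *)
Definition weak_sep col (m x y : T) := [\/ m = x, m = y | col m x <> col m y].

(* [col b p] is the color at [b] of the branch at [b] containing [p]; [tree]
   says that one of two points lies in the direction of any third one. *)
Record colored_tree B col := ColoredTree {
  tree : forall a b p, B a -> B b -> B p -> a <> b -> p <> a -> p <> b ->
    col a p = col a b \/ col b p = col b a;
  tree_kaleidoscopic : forall x y i j, B x -> B y -> x <> y -> i <> j ->
    exists z, [/\ B z, z <> x, z <> y, col z x = i & col z y = j];
  tree_leaf : forall x i, B x -> exists w, [/\ B w, w <> x & col x w = i];
  tree_median : forall x y z, B x -> B y -> B z -> x <> y -> x <> z -> y <> z ->
    exists m, [/\ B m, weak_sep col m x y, weak_sep col m x z & weak_sep col m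
      y z]
}.

Lemma weak_sepC col m x y : weak_sep col m x y -> weak_sep col m y x.
Proof. by case=> [->|->|/nesym];
  [constructor 2|constructor 1|constructor 3]. Qed.

Definition has_median col E x y z := exists m, [/\ m \in E,
  weak_sep col m.1 x y, weak_sep col m.1 x z & weak_sep col m.1 y z].

Lemma has_medianC col E x y z : has_median col E x y z -> has_median col E y x
  z.
Proof. by move=> [m [mE /weak_sepC h1 h2 h3]]; exists m. Qed.

Lemma has_medianCA col E x y z : has_median col E x y z -> has_median col E x z
  y.
Proof. by move=> [m [mE h1 h2 /weak_sepC h3]]; exists m. Qed.

(** The domain is kept closed under medians so that a new point has only two possible positions:
    inside an edge between two neighbouring points of the domain, or off a single one. *)
Record partial_iso B col col' E := PartialIso {
  pi_dom : forall u, u \in E -> B u.1;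
  pi_img : forall u, u \in E -> B u.2;
  pi_inj : forall u v, u \in E -> v \in E -> (u.1 = v.1 <-> u.2 = v.2);
  pi_col : forall u v, u \in E -> v \in E -> u.1 <> v.1 ->
    col u.1 v.1 = col' u.2 v.2;
  pi_median : forall u v w, u \in E -> v \in E -> w \in E ->
    u.1 <> v.1 -> u.1 <> w.1 -> v.1 <> w.1 -> has_median col E u.1 v.1 w.1
}.

Definition swap E : seq (T * T) := [seq (u.2, u.1) | u <- E].

Lemma mem_swap E u : (u \in swap E) = ((u.2, u.1) \in E).
Proof.
apply/mapP/idP => [[v vE ->]|uE]; first by rewrite -surjective_pairing.
by exists (u.2, u.1) => //=; rewrite -surjective_pairing.
Qed.

Lemma partial_iso_swap B col col' E :
  partial_iso B col col' E -> partial_iso B col' col (swap E).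
Proof.
move=> [h1 h2 h3 h4 h5]; split.
- by move=> u; rewrite mem_swap => /h2.
- by move=> u; rewrite mem_swap => /h1.
- by move=> u v; rewrite !mem_swap => uE vE; have [? ?] := h3 _ _ uE vE; split.
- move=> u v; rewrite !mem_swap => uE vE uv; rewrite -(h4 _ _ uE vE)//= => e.
  by apply: uv; apply: (h3 _ _ uE vE).1.
- move=> u v w; rewrite !mem_swap => uE vE wE uv uw vw.
  have inj p q : (p.2, p.1) \in E -> (q.2, q.1) \in E -> p.1 <> q.1 -> p.2 <>
    q.2.
    by move=> pE qE pq e; apply: pq; apply: (h3 _ _ pE qE).1.
  have [m [mE s1 s2 s3]] := h5 _ _ _ uE vE wE (inj _ _ uE vE uv) (inj _ _ uE wE
    uw) (inj _ _ vE wE vw).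
  have S p q : p \in E -> q \in E -> weak_sep col m.1 p.1 q.1 -> weak_sep col'
    m.2 p.2 q.2.
    move=> pE qE s; have [mp|mp] := eqVneq m.1 p.1.
      by constructor 1; apply: (h3 _ _ mE pE).1.
    have [mq|mq] := eqVneq m.1 q.1.
      by constructor 2; apply: (h3 _ _ mE qE).1.
    constructor 3; rewrite -!h4//; try exact/eqP.
    by case: s => // e; [rewrite e eqxx in mp|rewrite e eqxx in mq].
  exists (m.2, m.1); rewrite mem_swap -surjective_pairing; split => //=.
  + exact: (S (u.2, u.1) (v.2, v.1)).
  + exact: (S (u.2, u.1) (w.2, w.1)).
  + exact: (S (v.2, v.1) (w.2, w.1)).
Qed.

Section Extension.
Variables (B : set T) (col col' : T -> T -> K).
Hypotheses (tB : colored_tree B col) (tB' : colored_tree B col').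
Hypothesis two_colors : forall i : K, exists j, j <> i.

(** No point of the domain separates [x] from [z]: every other one gives both the same color. *)
Definition sees E z (x : T * T) :=
  forall y, y \in E -> y.1 <> x.1 -> col y.1 x.1 = col y.1 z.

(** When u and v lie beyond x as seen from z, the median of x, u and v is also that of u, v and
    z. *)
Lemma sees_median E z x u v : partial_iso B col col' E ->
  (forall y, y \in E -> y.1 <> z) -> x \in E -> u \in E -> v \in E ->
  sees E z x -> u.1 <> v.1 ->
  (u.1 <> x.1 -> col x.1 u.1 <> col x.1 z) ->
  (v.1 <> x.1 -> col x.1 v.1 <> col x.1 z) -> has_median col E u.1 v.1 z.
Proof.
move=> piE zE xE uE vE xz uv xu xv.
have [ux|/eqP ux] := eqVneq u.1 x.1.
  exists x; split => //; [by constructor 1|by constructor 1|].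
  by constructor 3; apply: xv; rewrite -ux; exact: nesym.
have [vx|/eqP vx] := eqVneq v.1 x.1.
  exists x; split => //; [by constructor 2| |by constructor 1].
  by constructor 3; exact: xu.
have [m [mE s1 s2 s3]] := pi_median piE xE uE vE (nesym ux) (nesym vx) uv.
have S w : w \in E -> w.1 <> x.1 -> col x.1 w.1 <> col x.1 z ->
    weak_sep col m.1 x.1 w.1 -> weak_sep col m.1 w.1 z.
  move=> wE wx xwz s; have [mx|/eqP mx] := eqVneq m.1 x.1.
    by constructor 3; rewrite mx.
  have [mw|/eqP mw] := eqVneq m.1 w.1; first by constructor 1.
  constructor 3; rewrite -(xz m mE mx); apply/nesym.
  by case: s.
exists m; split => //.
- by apply: S => //; exact: xu.
- by apply: S => //; exact: xv.
Qed.

Lemma partial_iso_cons E z z' : partial_iso B col col' E -> B z -> B z' ->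
  (forall y, y \in E -> y.1 <> z) ->
  (forall y, y \in E -> [/\ y.2 <> z', col y.1 z = col' y.2 z' &
     col z y.1 = col' z' y.2]) ->
  (forall u v, u \in E -> v \in E -> u.1 <> v.1 ->
     has_median col ((z, z') :: E) u.1 v.1 z) ->
  partial_iso B col col' ((z, z') :: E).
Proof.
move=> [h1 h2 h3 h4 h5] Bz Bz' zE colE med; split.
- by move=> u; rewrite inE => /predU1P[->//|/h1].
- by move=> u; rewrite inE => /predU1P[->//|/h2].
- move=> u v; rewrite !inE => /predU1P[->|uE] /predU1P[->|vE] //=;
  last exact: h3.
  + split => e; first by case: (zE _ vE).
    by have [] := colE _ vE; rewrite e.
  + split => e; first by case: (zE _ uE).
    by have [] := colE _ uE; rewrite e.
- move=> u v; rewrite !inE => /predU1P[->|uE] /predU1P[->|vE] //=;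
  last exact: h4.
  + by have [] := colE _ vE.
  + by have [] := colE _ uE.
- move=> u v w; rewrite !inE.
  move=> /predU1P[->|uE] /predU1P[->|vE] /predU1P[->|wE] //= uv uw vw.
  + by apply/has_medianC/has_medianCA; apply: med.
  + by apply/has_medianCA; apply: med.
  + exact: med.
  + have [m [mE ? ? ?]] := h5 _ _ _ uE vE wE uv uw vw.
    by exists m; split => //; rewrite inE mE orbT.
Qed.

(** Here [z] is alone in its branch at [x], so only its direction at [x] and the color it gives to
    [x] must be reproduced; all other points lie beyond [x]. *)
Lemma extend_leaf E z x : partial_iso B col col' E -> B z ->
  (forall y, y \in E -> y.1 <> z) -> x \in E -> sees E z x ->
  (forall y, y \in E -> y.1 <> x.1 -> col x.1 y.1 <> col x.1 z) ->
  exists z', partial_iso B col col' ((z, z') :: E).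
Proof.
move=> piE Bz zE xE xz alone.
have [Bx Bx'] := (pi_dom piE xE, pi_img piE xE).
(* [w] marks the right branch at the image of x, and [z'] is placed on the way to it. The color [j]
   towards [w] can be any one other than the color towards x. *)
have [w [Bw wx xw]] := tree_leaf tB' (col x.1 z) Bx'.
have [j jz] := two_colors (col z x.1).
have [z' [Bz' z'x z'w z'xE z'wE]] := tree_kaleidoscopic tB' Bx' Bw (nesym wx)
  (nesym jz).
have xz' : col' x.2 z' = col x.1 z.
  rewrite -xw; have [//|] := tree tB' Bx' Bz' Bw (nesym z'x) wx (nesym z'w).
  by rewrite z'xE z'wE.
exists z'; apply: partial_iso_cons => //.
- move=> y yE; have [By By'] := (pi_dom piE yE, pi_img piE yE).
  have [yx|/eqP yx] := eqVneq y.1 x.1.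
    have yx2 : y.2 = x.2 by apply/(pi_inj piE yE xE).
    by rewrite yx yx2 xz' z'xE; split => //; exact: nesym.
  have yx2 : y.2 <> x.2 by move/(pi_inj piE yE xE).
  have xy : col' x.2 y.2 <> col' x.2 z'.
    by rewrite xz' -(pi_col piE xE yE (nesym yx)); exact: alone.
  have yz' : y.2 <> z' by move=> e; rewrite e in xy.
  split => //.
  + have [e|->] := tree tB' Bx' By' Bz' (nesym yx2) z'x (nesym yz').
      by case: xy.
    by rewrite -(pi_col piE yE xE yx); exact/esym/xz.
  + have [e|->] := tree tB' Bx' Bz' By' (nesym z'x) yx2 yz'.
      by case: xy.
    rewrite z'xE; have [e|//] := tree tB Bx Bz By (zE _ xE) yx (zE _ yE).
    by case: (alone _ yE yx).
- move=> u v uE vE uv.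
  have [m [mE ? ? ?]] := sees_median piE zE xE uE vE xz uv (alone _ uE) (alone
    _ vE).
  by exists m; split => //; rewrite inE mE orbT.
Qed.

(** If [w] were on the same side as [z] at both ends, the median of x, y and w, which is in the
    domain, would separate one of the ends from [z]. *)
Lemma edge_side E z x y w : partial_iso B col col' E -> B z ->
  (forall y, y \in E -> y.1 <> z) -> x \in E -> y \in E -> w \in E ->
  x.1 <> y.1 -> sees E z x -> sees E z y -> w.1 <> x.1 -> w.1 <> y.1 ->
  col x.1 w.1 <> col x.1 z \/ col y.1 w.1 <> col y.1 z.
Proof.
move=> piE Bz zE xE yE wE xy xz yz wx wy.
have [m [mE s1 s2 s3]] := pi_median piE xE yE wE xy (nesym wx) (nesym wy).
have [mx|/eqP mx] := eqVneq m.1 x.1.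
  left; rewrite mx in s3; case: s3 => [//|/esym//|].
  by rewrite (yz x xE xy) => /nesym.
have [my|/eqP my] := eqVneq m.1 y.1.
  right; rewrite my in s2; case: s2 => [/esym//|/esym//|].
  by rewrite (xz y yE (nesym xy)) => /nesym.
case: s1 => // ; case.
by rewrite (xz m mE mx) (yz m mE my).
Qed.

Lemma side_col z x w : B z -> B x -> B w -> x <> z -> w <> x -> w <> z ->
  col x w <> col x z -> col z w = col z x.
Proof. by move=> Bz Bx Bw xz wx wz h;
  have [|//] := tree tB Bx Bz Bw xz wx wz. Qed.

Lemma side_col' z x w : B z -> B x -> B w -> x <> z -> w <> x -> w <> z ->
  col' x w <> col' x z -> col' z w = col' z x.
Proof. by move=> Bz Bx Bw xz wx wz h;
  have [|//] := tree tB' Bx Bz Bw xz wx wz. Qed.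

(** The kaleidoscopic property puts [z'] between the images of x and y with the two prescribed
    colors. By [edge_side] every other point lies beyond x or beyond y, and [half] treats one
    end. *)
Lemma extend_edge E z x y : partial_iso B col col' E -> B z ->
  (forall y, y \in E -> y.1 <> z) -> x \in E -> y \in E -> x.1 <> y.1 ->
  sees E z x -> sees E z y -> col z x.1 <> col z y.1 ->
  exists z', partial_iso B col col' ((z, z') :: E).
Proof.
move=> piE Bz zE xE yE xy xz yz zxy.
have D u (uE : u \in E) := pi_dom piE uE;
  have I u (uE : u \in E) := pi_img piE uE.
have neq2 u v : u \in E -> v \in E -> u.1 <> v.1 -> u.2 <> v.2.
  by move=> uE vE uv /(pi_inj piE uE vE).
have [z' [Bz' z'x z'y z'xE z'yE]] :=
  tree_kaleidoscopic tB' (I _ xE) (I _ yE) (neq2 _ _ xE yE xy) zxy.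
have half a b : a \in E -> b \in E -> a.1 <> b.1 -> sees E z a -> sees E z b ->
    col' z' a.2 = col z a.1 -> col' z' a.2 <> col' z' b.2 -> z' <> a.2 -> z' <>
      b.2 ->
    col' a.2 z' = col a.1 z /\
    (forall w, w \in E -> w.1 <> a.1 -> col a.1 w.1 <> col a.1 z ->
      [/\ w.2 <> z', col w.1 z = col' w.2 z' & col z w.1 = col' z' w.2]).
  move=> aE bE ab az bz z'aE z'ab z'a z'b.
  have az' : col' a.2 z' = col a.1 z.
    rewrite -(bz a aE ab) (pi_col piE aE bE ab).
    have [e|e] := tree tB' (I _ aE) Bz' (I _ bE) (nesym z'a) (neq2 _ _ bE aE
      (nesym ab)) (nesym z'b).
      by [].
    by case: z'ab.
  split => // w wE wa aw.
  have wa2 := neq2 _ _ wE aE wa.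
  have aw' : col' a.2 w.2 <> col' a.2 z'.
    by rewrite az' -(pi_col piE aE wE (nesym wa)).
  have wz' : w.2 <> z' by move=> e; rewrite e in aw'.
  split => //.
  - rewrite (@side_col' w.2 a.2 z') //; try exact: I; try exact: nesym.
    by rewrite -(pi_col piE wE aE wa); exact/esym/az.
  - rewrite (@side_col' z' a.2 w.2) //; try exact: I; try exact: nesym.
    rewrite z'aE; apply: side_col => //; by [exact: D|exact: zE].
have [xz' xhalf] := half x y xE yE xy xz yz z'xE ltac:(by rewrite z'xE z'yE)
  z'x z'y.
have [yz' yhalf] := half y x yE xE (nesym xy) yz xz z'yE ltac:(by rewrite z'xE
  z'yE; exact: nesym) z'y z'x.
have side w : w \in E -> (w.1 <> x.1 -> col x.1 w.1 <> col x.1 z) /\ col z w.1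
  = col z x.1 \/
    (w.1 <> y.1 -> col y.1 w.1 <> col y.1 z) /\ col z w.1 = col z y.1.
  move=> wE; have [wx|/eqP wx] := eqVneq w.1 x.1; first by left; rewrite wx.
  have [wy|/eqP wy] := eqVneq w.1 y.1; first by right; rewrite wy.
  have [h|h] := edge_side piE Bz zE xE yE wE xy xz yz wx wy; [left|right].
    by split => //; apply: side_col => //; by [exact: D|exact: zE].
  by split => //; apply: side_col => //; by [exact: D|exact: zE].
exists z'; apply: partial_iso_cons => //.
- move=> w wE; have [wx|/eqP wx] := eqVneq w.1 x.1.
    have -> : w.2 = x.2 by apply/(pi_inj piE wE xE).
    by rewrite wx z'xE xz'; split => //; exact: nesym.
  have [wy|/eqP wy] := eqVneq w.1 y.1.
    have -> : w.2 = y.2 by apply/(pi_inj piE wE yE).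
    by rewrite wy z'yE yz'; split => //; exact: nesym.
  have [h|h] := edge_side piE Bz zE xE yE wE xy xz yz wx wy; first exact: xhalf.
  exact: yhalf.
- move=> u v uE vE uv.
  have [[hu cu]|[hu cu]] := side u uE; have [[hv cv]|[hv cv]] := side v vE.
  + have [m [mE ? ? ?]] := sees_median piE zE xE uE vE xz uv hu hv.
    by exists m; split => //; rewrite inE mE orbT.
  + exists (z, z'); rewrite inE eqxx; split => //=.
    * by constructor 3; rewrite cu cv.
    * by constructor 2.
    * by constructor 2.
  + exists (z, z'); rewrite inE eqxx; split => //=.
    * by constructor 3; rewrite cu cv; exact: nesym.
    * by constructor 2.
    * by constructor 2.
  + have [m [mE ? ? ?]] := sees_median piE zE yE uE vE yz uv hu hv.
    by exists m; split => //; rewrite inE mE orbT.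
Qed.

(** Take x visible from z. If the branch of x towards z contains no point of the domain, z is a leaf
    at x. Otherwise take a visible y in that branch, insert the median m of x, y and z into the edge
    from x to y, and attach z to m as a leaf unless z = m. *)
Lemma extend_point E z : partial_iso B col col' E -> E != [::] -> B z ->
  exists E', [/\ partial_iso B col col' E', {subset E <= E'} &
    exists z', (z, z') \in E'].
Proof.
move=> piE E0 Bz.
have [[u uE uz]|nz] := pselect (exists2 u, u \in E & u.1 = z).
  exists E; split => //; exists u.2; by rewrite -uz -surjective_pairing.
have zE u : u \in E -> u.1 <> z by move=> uE uz; apply: nz; exists u.
have D u (uE : u \in E) := pi_dom piE uE.
(* [r y x] says that y separates x from z. This is a strict order whose minimal elements are the
   points visible from z. *)
pose r (y x : T * T) := y.1 <> x.1 /\ col y.1 x.1 <> col y.1 z.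
have irr x : x \in E -> ~ r x x by move=> _ [].
have tr w y x : w \in E -> y \in E -> x \in E -> r w y -> r y x -> r w x.
  move=> wE yE xE [wy cwy] [yx cyx].
  have ywE : col y.1 w.1 = col y.1 z.
    by have [|//] := tree tB (D _ wE) (D _ yE) Bz wy (nesym (zE _ wE)) (nesym
      (zE _ yE)) => /esym.
  have wx : w.1 <> x.1 by move=> e; apply: cyx; rewrite -e.
  split => // cwx; apply: cyx; rewrite -ywE.
  have [e|//] := tree tB (D _ wE) (D _ yE) (D _ xE) wy (nesym wx) (nesym yx).
  by case: cwy; rewrite -e.
have minimal := seq_minimal irr tr.
have minsees (P : T * T -> Prop) x : x \in E -> P x ->
    (forall y, y \in E -> r y x -> P y) ->
    (forall y, y \in E -> P y -> ~ r y x) -> sees E z x.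
  move=> xE Px Pdown Pmin y yE yx; apply: contrapT => cyx.
  have ryx : r y x by split.
  exact: (Pmin y yE (Pdown y yE ryx) ryx).
have [x [xE _ xmin]] : exists x, [/\ x \in E, True & forall y, y \in E -> True
  -> ~ r y x].
  apply: minimal; case: E E0 {piE nz zE D r irr tr minsees} => // x E _.
  by exists x => //; rewrite inE eqxx.
have xz : sees E z x by apply: (minsees (fun=> True)).
have [[y yE [yx cxy]]|alone] := pselect (exists2 y, y \in E & y.1 <> x.1 /\ col
  x.1 y.1 = col x.1 z); last first.
  have [|z' piz] := extend_leaf piE Bz zE xE xz.
    by move=> y yE yx cxy; apply: alone; exists y.
  exists ((z, z') :: E); split => //; first by move=> u uE; rewrite inE uE orbT.
  by exists z'; rewrite inE eqxx.
pose P (y : T * T) := y.1 <> x.1 /\ col x.1 y.1 = col x.1 z.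
have {y yE yx cxy}[y [yE [yx cxy] ymin]] : exists x, [/\ x \in E, P x & forall
  y, y \in E -> P y -> ~ r y x].
  by apply: minimal; exists y.
have yz : sees E z y.
  apply: (minsees P) => // w wE [wy cwy].
  have wx : w.1 <> x.1 by move=> wx; apply: cwy; rewrite wx.
  split => //; rewrite -cxy.
  have [|e] := tree tB (D _ xE) (D _ wE) (D _ yE) (nesym wx) yx (nesym wy) =>
    [/esym//|].
  by case: cwy; rewrite e; exact: xz.
(* [m] is not yet in the domain: it separates x from y, while a point of the domain gives both of
   them the color of z. *)
have [m [Bm s1 s2 s3]] := tree_median tB (D _ xE) (D _ yE) Bz (nesym yx) (zE _
  xE) (zE _ yE).
have mx : m <> x.1.
  by move=> mx; rewrite mx in s3; case: s3 => [/esym//||//]; exact: zE.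
have my : m <> y.1.
  move=> my; rewrite my in s2; case: s2 => [//||]; first exact: zE.
  by rewrite (xz y yE yx).
have cmxy : col m x.1 <> col m y.1 by case: s1.
have mE w : w \in E -> w.1 <> m.
  move=> wE wm; apply: cmxy; rewrite -wm.
  by rewrite (xz w wE) ?(yz w wE) // wm.
have midE a b w : a \in E -> b \in E -> w \in E -> a.1 <> b.1 ->
    sees E z a -> sees E z b -> col m a.1 <> col m b.1 -> w.1 <> a.1 ->
    col w.1 a.1 = col w.1 m.
  move=> aE bE wE ab az bz cab wa.
  have [wb|/eqP wb] := eqVneq w.1 b.1.
    by rewrite wb; have [|] := tree tB (D _ bE) Bm (D _ aE) (mE _ bE) ab (mE _
      aE).
  apply: contrapT => h; apply: cab.
  rewrite (side_col Bm (D _ wE) (D _ aE) (mE _ wE) (nesym wa) (mE _ aE) h).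
  apply/esym/(side_col Bm (D _ wE) (D _ bE) (mE _ wE) (nesym wb) (mE _ bE)).
  by rewrite (bz w wE wb) -(az w wE wa).
have xm : sees E m x by move=> w wE; apply: (midE x y) => //; exact: nesym.
have ym : sees E m y.
  by move=> w wE; apply: (midE y x) => // /esym.
have [m' pim] := extend_edge piE Bm mE xE yE (nesym yx) xm ym cmxy.
have [<-|/eqP mz] := eqVneq m z.
  exists ((m, m') :: E); split => //; first by move=> u uE; rewrite inE uE orbT.
  by exists m'; rewrite inE eqxx.
have zm : sees ((m, m') :: E) z (m, m').
  move=> w; rewrite inE => /predU1P[->//|wE] /= _.
  have [wx|/eqP wx] := eqVneq w.1 x.1; last by rewrite -(xm w wE wx); exact: xz.
  have wy : w.1 <> y.1 by rewrite wx; exact: nesym.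
  by rewrite -(ym w wE wy); exact: yz.
have [||w wE wm|z' piz] := extend_leaf pim Bz _ _ zm.
- by move=> w; rewrite inE => /predU1P[->//|]; exact: zE.
- by rewrite inE eqxx.
- move: wE wm; rewrite inE => /predU1P[->//|wE] /= wm.
  have cx : col m x.1 <> col m z by case: s2.
  have cy : col m y.1 <> col m z by case: s3.
  have [wx|/eqP wx] := eqVneq w.1 x.1; first by rewrite wx.
  have [wy|/eqP wy] := eqVneq w.1 y.1; first by rewrite wy.
  have [h|h] := edge_side piE Bm mE xE yE wE (nesym yx) xm ym wx wy.
    by rewrite (side_col Bm (D _ xE) (D _ wE) _ wx wm h)//; exact: mE.
  by rewrite (side_col Bm (D _ yE) (D _ wE) _ wy wm h)//; exact: mE.
exists [:: (z, z'), (m, m') & E]; split => //.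
  by move=> u uE; rewrite !inE uE !orbT.
by exists z'; rewrite inE eqxx.
Qed.

End Extension.

Lemma back_and_forth B col col' E : countable B ->
  colored_tree B col -> colored_tree B col' ->
  (forall i : K, exists j, j <> i) ->
  partial_iso B col col' E -> E != [::] ->
  exists phi psi : T -> T,
    [/\ forall x, B x -> B (phi x) /\ psi (phi x) = x,
        forall x, B x -> B (psi x) /\ phi (psi x) = x,
        forall x y, B x -> B y -> x <> y -> col' (phi x) (phi y) = col x y &
        forall u, u \in E -> phi u.1 = u.2].
Proof.
move=> cB tB tB' two piE E0.
have [x0 Bx0] : exists x, B x.
  case: E piE E0 => // u E piE _; exists u.1.
  by apply: (pi_dom piE); rewrite inE eqxx.
have [e eB eS] : exists2 e : nat -> T, (forall n, B (e n)) & forall x, B x ->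
  exists n, e n = x.
  have /countable_injP[f fI] := cB.
  have /choice[e eP] : forall n, exists x, B x /\ ((exists2 y, B y & f y = n)
    -> f x = n).
    move=> n; have [[y By fy]|h] := pselect (exists2 y, B y & f y = n).
      by exists y.
    by exists x0; split.
  exists e => [n|x Bx]; first by have [] := eP n.
  have [Be fe] := eP (f x); exists (f x); apply: fI; rewrite ?inE//.
  by apply: fe; exists x.
pose P (n : nat) E' := partial_iso B col col' E' /\ E' != [::].
pose Q n E1 E2 := [/\ {subset E1 <= E2}, exists y, (e n, y) \in E2 &
   exists y, (y, e n) \in E2].
have step n E1 : P n E1 -> exists E2, P n.+1 E2 /\ Q n E1 E2.
  move=> [iso1 E10].
  have [E2 [iso2 E12 [y yE2]]] := extend_point tB tB' two iso1 E10 (eB n).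
  have E20 : swap E2 != [::] by case: E2 yE2 {iso2 E12}.
  (* The back half of the step is the forth half applied to the swapped pairs. *)
  have [E3 [iso3 E23 [z zE3]]] := extend_point tB' tB two (partial_iso_swap
    iso2) E20 (eB n).
  have E23' : {subset E2 <= swap E3}.
    by move=> u uE2; rewrite mem_swap; apply: E23;
      rewrite mem_swap -surjective_pairing.
  exists (swap E3); split; first split.
  - exact: partial_iso_swap.
  - by case: E3 zE3 {iso3 E23 E23'}.
  split; first by move=> u /E12/E23'.
  - by exists y; exact: E23'.
  - by exists z; rewrite mem_swap.
have [u [u0 uP]] := nat_dependent_choice (conj piE E0 : P 0%N E) step.
have mono m n : (m <= n)%N -> {subset u m <= u n}.
  move=> /subnKC <-; elim: (n - m)%N => [|k IH]; first by rewrite addn0.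
  by rewrite addnS => v /IH; have [_ [+ _ _]] := uP (m + k)%N; apply.
pose G p := exists n, p \in u n.
have Gpi p q : G p -> G q -> exists n, [/\ partial_iso B col col' (u n), p \in
  u n & q \in u n].
  move=> [m pm] [n qn]; exists (maxn m n); split;
    first by have [[]] := uP (maxn m n).
    exact: (mono m _ (leq_maxl _ _)).
  exact: (mono n _ (leq_maxr _ _)).
have /choice[phi phiP] : forall x, exists y, B x -> G (x, y).
  move=> x; have [/eS[n <-]|] := pselect (B x); last by exists x.
  by have [_ [_ [y yu] _]] := uP n; exists y => _; exists n.+1.
have /choice[psi psiP] : forall y, exists x, B y -> G (x, y).
  move=> y; have [/eS[n <-]|] := pselect (B y); last by exists y.
  by have [_ [_ _ [x xu]]] := uP n; exists x => _; exists n.+1.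
have G1 p q : G p -> G q -> p.1 = q.1 -> p.2 = q.2.
  by move=> Gp Gq; have [n [pin pn qn]] := Gpi p q Gp Gq;
    move/(pi_inj pin pn qn).
have G2 p q : G p -> G q -> p.2 = q.2 -> p.1 = q.1.
  by move=> Gp Gq; have [n [pin pn qn]] := Gpi p q Gp Gq;
    move/(pi_inj pin pn qn).
have GB p : G p -> B p.1 /\ B p.2.
  move=> Gp; have [n [pin pn _]] := Gpi p p Gp Gp.
  by split; [exact: (pi_dom pin)|exact: (pi_img pin)].
exists phi, psi; split.
- move=> x Bx; have [_ Bphi] := GB _ (phiP x Bx); split => //.
  exact: (G2 _ _ (psiP _ Bphi) (phiP x Bx) erefl).
- move=> x Bx; have [Bpsi _] := GB _ (psiP x Bx); split => //.
  exact: (G1 _ _ (phiP _ Bpsi) (psiP x Bx) erefl).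
- move=> x y Bx By xy; have [n [pin xn yn]] := Gpi _ _ (phiP x Bx) (phiP y By).
  exact/esym/(pi_col pin xn yn).
- move=> v vE; have Gv : G v by exists 0%N; rewrite u0.
  by have [Bv _] := GB _ Gv; exact: (G1 _ _ (phiP _ Bv) Gv erefl).
Qed.

End BackAndForth.
(** * Branch points of Wazewski dendrites *)

Local Notation arc := Defs.arc.

Lemma comp_at_subset (R : realType) (X : metricType R) (K : set X) x y z :
  connected K -> K x -> K y -> comp_at z x <> comp_at z y -> K z.
Proof.
move=> cK Kx Ky zxy; apply: contrapT => Kz; apply: zxy.
apply: same_connected_component; exists K => //; split => //.
by move=> w Kw wz; apply: Kz; rewrite -wz.
Qed.

Lemma comp_at_refl (R : realType) (X : metricType R) (x y : X) :
  y <> x -> comp_at x y y.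
Proof. by move=> yx; exact: connected_component_refl. Qed.

Lemma comp_atP (R : realType) (X : metricType R) (x y z : X) : z <> x ->
  comp_at x y z <-> comp_at x y = comp_at x z.
Proof.
move=> zx; split=> [|->]; [exact: same_connected_component|exact: comp_at_refl].
Qed.

Section WazewskiDendrite.
Context {R : realType} (X : metricType R) (n : option nat).
Hypothesis hX : wazewski X n.
Implicit Types x y z p q a b m : X.

Let dX : dendrite X. Proof. by case: hX. Qed.
Let cX : compact [set: X]. Proof. by case: dX. Qed.
Let lcX : locally_connected X. Proof. by case: dX. Qed.

Lemma open_comp_at x y : open (comp_at x y).
Proof.
apply: open_component => //; apply: closed_openC.
exact: accessible_closed_set1 (hausdorff_accessible (@metric_hausdorff _ X)) _.
Qed.

(** The Wazewski condition places a branch point in [open_arc x y], so the choice defining [arc] did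
    not fall back on the empty set. *)
Lemma arcP x y : x <> y -> arc_between x y (arc x y).
Proof.
move=> xy; have [_ _ _ /(_ x y xy)[z [[zxy _] _]]] := hX.
by move: zxy; rewrite /arc; case: xgetP => [A _ AA _|_ []].
Qed.

Lemma arc_ends x y : x <> y -> arc x y x /\ arc x y y.
Proof.
move=> /arcP[f [[[fA _ _] _ _] f0 f1]]; split.
  by rewrite -[X in arc _ _ X]f0; apply: fA; rewrite /= in_itv/= lexx ler01.
by rewrite -[X in arc _ _ X]f1; apply: fA; rewrite /= in_itv/= lexx ler01.
Qed.

Lemma compact_arc x y : x <> y -> compact (arc x y).
Proof.
move=> /arcP[f [[[fA _ fS] fC _] _ _]].
have -> : arc x y = f @` `[0, 1].
  by apply/seteqP; split => // _ [t t01 <-]; exact: fA.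
by apply: continuous_compact => //; exact: segment_compact.
Qed.

Lemma connected_arc x y : x <> y -> connected (arc x y).
Proof.
move=> /arcP[f [[[fA _ fS] fC _] _ _]].
have -> : arc x y = f @` `[0, 1].
  by apply/seteqP; split => // _ [t t01 <-]; exact: fA.
by apply: connected_continuous_connected => //; exact: segment_connected.
Qed.

Lemma arc_sep x y z : x <> y -> arc x y z -> z <> x -> z <> y ->
  comp_at z x <> comp_at z y.
Proof. by move=> /arcP; exact: arc_between_separates. Qed.

Lemma open_arcP x y z : x <> y -> open_arc x y z <->
  [/\ z <> x, z <> y & comp_at z x <> comp_at z y].
Proof.
move=> xy; split=> [[zxy /not_orP[zx zy]]|[zx zy h]].
  by split => //; exact: arc_sep.
split; last by move=> [].
have [Ax Ay] := arc_ends xy; exact: comp_at_subset (connected_arc xy) Ax Ay h.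
Qed.

Lemma separating_branch x y : x <> y ->
  exists b, [/\ branch b, b <> x, b <> y & comp_at b x <> comp_at b y].
Proof.
move=> xy; have [_ _ _ /(_ x y xy)[b [/(open_arcP _ xy)[bx by_ h] bb]]] := hX.
by exists b.
Qed.

Lemma closure_comp_at x y : y <> x -> closure (comp_at x y) x.
Proof.
move=> yx; apply: contrapT => nx.
have clC : closed (comp_at x y).
  rewrite closure_id eqEsubset; split; first exact: subset_closure.
  move=> z cz; exists (closure (comp_at x y)) => //; split.
  - exact/subset_closure/comp_at_refl.
  - by move=> w cw wx; apply: nx; move: cw; rewrite wx.
  - exact/connected_closure/component_connected.
have [_ _ conX _ _] := dX.
have : comp_at x y = [set: X].
  apply: conX; first by exists y; exact: comp_at_refl.
    by exists (comp_at x y); rewrite ?setTI//; exact: open_comp_at.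
  by exists (comp_at x y); rewrite ?setTI.
move=> /seteqP[_ /(_ x Logic.I)]; move=> /connected_component_sub; exact.
Qed.

(** The closure of the component of p at a is connected and contains p and a. If b separated p from
    a, it would contain b, and then the open component of b at a would meet that of p. *)
Lemma comp_at_tree a b p : a <> b ->
  comp_at a p = comp_at a b \/ comp_at b p = comp_at b a.
Proof.
move=> ab; have [->|/eqP pa] := eqVneq p a; first by right.
have [h|h] := pselect (comp_at a p = comp_at a b); [by left|right].
apply: contrapT => h'.
have : closure (comp_at a p) b.
  apply: (comp_at_subset _ _ _ h').
  - exact/connected_closure/component_connected.
  - exact/subset_closure/comp_at_refl.
  - exact: closure_comp_at.
move=> /(_ (comp_at a b))[|q [qp qb]].
  by apply: open_nbhs_nbhs; split;
    [exact: open_comp_at|exact/comp_at_refl/nesym].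
have qa : q <> a by exact: connected_component_sub qp.
by apply: h; move/(comp_atP _ qa) : qp => ->; move/(comp_atP _ qa) : qb.
Qed.

(** A short initial piece of an arc starting at p stays in [U], and a branch point separating its
    ends must lie on it. *)
Lemma open_has_branch (U : set X) p : open U -> U p -> exists2 b, branch b & U
  b.
Proof.
move=> oU Up; have [q pq] : exists q, p <> q.
  have [_ [x [y xy]] _ _] := hX.
  by have [px|px] := pselect (p = x); [exists y; rewrite px|exists x].
have [f [fA f0 f1]] := arcP pq.
have [fC fI _] := set_homeo_clamp fA.
have : nbhs (0 : R) ((f \o clamp) @^-1` U).
  apply: fC; rewrite /= clamp_id ?lexx ?ler01// f0.
  exact: open_nbhs_nbhs.
move=> /nbhs_ballP[e /= e0 eU].
pose t := Num.min (e / 2) 1.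
have t0 : 0 < t by rewrite lt_min ltr01 divr_gt0.
have t1 : t <= 1 by rewrite ge_min lexx orbT.
have te : t < e.
  by apply: (@le_lt_trans _ _ (e / 2));
    [rewrite ge_min lexx|rewrite ltr_pdivrMr // ltr_pMr // ltr1n].
have ft : (f \o clamp) 0 <> (f \o clamp) t.
  move=> /fI; rewrite !inE /= !in_itv/= lexx ler01 (ltW t0) t1 => /(_ isT isT)
    h.
  by rewrite -h ltxx in t0.
have [b [bb _ _ bs]] := separating_branch ft; exists b => //.
have [] : ((f \o clamp) @` `[0, t]) b; last first.
  move=> s + <-; rewrite /= in_itv/= => /andP[s0 st]; apply: eU.
  by rewrite /ball/= sub0r normrN ger0_norm// (le_lt_trans st).
apply: (comp_at_subset _ _ _ bs).
- apply: connected_continuous_connected; first exact: segment_connected.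
  exact: continuous_subspaceT.
- by exists 0 => //; rewrite /= in_itv/= lexx ltW.
- by exists t => //; rewrite /= in_itv/= lexx ltW.
Qed.

(** The arc from x to y is covered by its intersections with the closed arcs from x to z and from y
    to z. Being connected, it has a point in both. *)
Lemma median_exists x y z : x <> y -> x <> z -> y <> z -> exists m,
  [/\ arc x y m, arc x z m & arc y z m].
Proof.
move=> xy xz yz.
pose I (w : X) := arc x y `&` arc w z.
have clI w : w <> z -> closed (I w).
  move=> wz; apply: compact_closed; first exact: metric_hausdorff.
  apply: compact_closedI; first exact: compact_arc.
  by apply: compact_closed; [exact: metric_hausdorff|exact: compact_arc].
have [Axy_x Axy_y] := arc_ends xy.
have [Axz_x _] := arc_ends xz; have [Ayz_y Ayz_z] := arc_ends yz.
have cover m : arc x y m -> I x m \/ I y m.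
  move=> xym; have [->|/eqP mx] := eqVneq m x; first by left.
  have [->|/eqP my] := eqVneq m y; first by right.
  have [mz|/eqP mz] := eqVneq m z; first by right; split => //; rewrite mz.
  have [mzx|h] := pselect (comp_at m x = comp_at m z); [right|left];
    split => //.
    apply: (comp_at_subset (connected_arc yz) Ayz_y Ayz_z) => h.
    by apply: (arc_sep xy xym mx my); rewrite mzx h.
  have [A1 A2] := arc_ends xz.
  exact: (comp_at_subset (connected_arc xz) A1 A2).
apply: contrapT => nm.
have disj m : I x m -> ~ I y m.
  by move=> [xym xzm] [_ yzm]; apply: nm; exists m.
have Ixy : I x = arc x y.
  apply: connected_arc => //; first by exists x.
    exists (~` I y); first exact/closed_openC/clI.
    apply/seteqP; split => m; first by move=> Im; split; [case: Im|exact: disj].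
    by move=> [/cover[]].
  exists (I x); first exact: clI.
  by rewrite /I setIA setIid.
by apply: (disj y); [rewrite Ixy|split].
Qed.

End WazewskiDendrite.

Lemma compact_metric_second_countable (R : realType) (X : metricType R) :
  compact [set: X] -> @second_countable X.
Proof.
move=> cX; have [[x0 _]|nX] := pselect ([set: X] !=set0); last first.
  exists set0; first exact: countable0.
  by split => // x; case: nX; exists x.
pose T : pseudoPMetricType R :=
  HB.pack (Metric.sort X) (isPointed.Build (Metric.sort X) x0).
exact: (@compact_second_countable R T cX).
Qed.

Lemma three_colors (n : option nat) : at_least3 n ->
  exists i j k : colors n, [/\ i <> j, i <> k & j <> k].
Proof.
move=> hn.
have col m : (m < 3)%N -> exists i : colors n, val i = m.
  move=> m3; have mn : m \in colors n.
    by rewrite inE; case: n hn => //= N; exact: leq_trans.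
  by exists (SigSub mn).
have [i i0] := col 0%N isT; have [j j1] := col 1%N isT;
  have [k k2] := col 2%N isT.
by exists i, j, k; split => e;
  [rewrite e j1 in i0|rewrite e k2 in i0|rewrite e k2 in j1].
Qed.

Lemma other_colors (n : option nat) (i : colors n) : at_least3 n ->
  exists j k : colors n, [/\ j <> i, k <> i & j <> k].
Proof.
move=> /three_colors[a [b [d [ab ad bd]]]].
have [ai|ai] := pselect (a = i); first by exists b, d; rewrite -ai;
  split => //; exact: nesym.
have [bi|bi] := pselect (b = i); last by exists a, b.
by exists a, d; rewrite -bi; split => //; exact: nesym.
Qed.

Section Colorings.
Context {R : realType} (X : metricType R) (n : option nat).
Hypotheses (hn : at_least3 n) (hX : wazewski X n).
Implicit Types (x y z p q a b m : X) (c : X -> set X -> colors n).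

Definition color_at c b p := c b (comp_at b p).

Lemma col_comp_at c b p q : coloring c -> branch b -> p <> b -> q <> b ->
  color_at c b p = color_at c b q <-> comp_at b p = comp_at b q.
Proof.
move=> cc bb pb qb; split => [|e]; last by rewrite /color_at e.
have [_ cI _] := cc b bb.
by apply: cI; rewrite inE; [exists p|exists q].
Qed.

Lemma col_tree c a b p : a <> b -> color_at c a p = color_at c a b \/ color_at
  c b p = color_at c b a.
Proof. by move=> ab; rewrite /color_at; have [->|->] := comp_at_tree hX p ab;
  [left|right]. Qed.

Lemma col_onto c b i : coloring c -> branch b ->
  exists w, [/\ branch w, w <> b & color_at c b w = i].
Proof.
move=> cc bb; have [_ _ /(_ i Logic.I)[_ [y yb <-] <-]] := cc b bb.
have [w bw yw] := open_has_branch hX (open_comp_at hX b y) (comp_at_refl yb).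
have wb : w <> b by exact: connected_component_sub yw.
by exists w; split => //; rewrite /color_at; congr (c b _); apply/esym/comp_atP.
Qed.

Lemma separating_col c p q : coloring c -> p <> q ->
  exists b, [/\ branch b, b <> p, b <> q & color_at c b p <> color_at c b q].
Proof.
move=> cc pq; have [b [bb bp bq h]] := separating_branch hX pq.
by exists b; split => // /(col_comp_at cc bb (nesym bp) (nesym bq)).
Qed.

Lemma median_branch x y z m : branch x -> branch y -> branch z ->
  x <> y -> x <> z -> y <> z -> arc x y m -> arc x z m -> arc y z m -> branch m.
Proof.
move=> bx by_ bz xy xz yz xym xzm yzm.
have [->//|/eqP mx] := eqVneq m x.
have [->//|/eqP my] := eqVneq m y.
have [->//|/eqP mz] := eqVneq m z.
pose f k := if k is k'.+1 then if k' is 0%N then comp_at m y else comp_at m z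
  else comp_at m x.
have cxy := arc_sep hX xy xym mx my.
have cxz := arc_sep hX xz xzm mx mz.
have cyz := arc_sep hX yz yzm my mz.
have fI : {in `I_3 &, injective f}.
  move=> [|[|[|i]]] [|[|[|j]]] /[!inE] //= h1 h2 e; exfalso.
  - exact: cxy (esym e).
  - exact: cxz (esym e).
  - exact: cyz (esym e).
have := inj_card_eq fI; rewrite card_eq_le => /andP[_ h].
apply: card_le_trans h _; apply: subset_card_le => _ [[|[|i]] _ <-] /=.
- by exists x => //; exact: nesym.
- by exists y => //; exact: nesym.
- by exists z => //; exact: nesym.
Qed.

(** Each branch point b chooses, for each of three colors, a basic open set inside its branch of
    that color. If a and b chose the same set for a color, this color would be that of b at a or
    that of a at b. Two values cannot account for three colors. *)
Lemma countable_branch c : coloring c -> countable (@branch R X).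
Proof.
move=> cc; have [_ cX _ _ _] : dendrite X by case: hX.
have [B cB [oB basisB]] := compact_metric_second_countable cX.
have [i [j [k [ij ik jk]]]] := three_colors hn.
have pick b s : branch b -> exists V : set X, [/\ B V, V !=set0 &
    forall v, V v -> v <> b /\ color_at c b v = s].
  move=> bb; have [w [bw wb ws]] := col_onto s cc bb.
  have /basisB[V [BV Vw] VC] : nbhs w (comp_at b w).
    by apply: open_nbhs_nbhs; split;
      [exact: (open_comp_at hX)|exact: comp_at_refl].
  exists V; split => //; first by exists w.
  move=> v /VC bwv; have vb : v <> b by exact: connected_component_sub bwv.
  by split => //; rewrite -ws; apply/esym/col_comp_at => //; apply/comp_atP.
have /choice[f fP] : forall bs : X * colors n, exists V : set X, branch bs.1 ->
    [/\ B V, V !=set0 & forall v, V v -> v <> bs.1 /\ color_at c bs.1 v = bs.2].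
  move=> [b s]; have [bb|nb] := pselect (branch b); last by exists set0.
  by have [V VP] := pick b s bb; exists V.
pose g b := (f (b, i), f (b, j), f (b, k)).
have gI : {in @branch R X &, injective g}.
  move=> a b; rewrite !inE => ba bb gab; apply: contrapT => ab.
  have mem s : f (a, s) = f (b, s) -> s = color_at c a b \/ s = color_at c b a.
    move=> fab; have [_ [v fv] fa] := fP (a, s) ba;
      have [_ _ fb] := fP (b, s) bb.
    rewrite -fab in fb.
    have [vb sb] := fb v fv; have [va sa] := fa v fv.
    rewrite /= in sa sb.
    by have [e|e] := col_tree c v ab; [left; rewrite -e sa|right;
      rewrite -e sb].
  case: gab => /mem ia /mem ja /mem ka.
  by case: ia ja ka => ie [] je [] ke; (try by apply: ij; rewrite ie je);
    (try by apply: ik; rewrite ie ke); apply: jk; rewrite je ke.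
have := inj_card_eq gI; rewrite card_eq_le => /andP[_ h].
apply: sub_countable h _;
  apply: sub_countable (countableX (countableX cB cB) cB).
apply: subset_card_le => _ [b bb <-]; rewrite /g.
split => /=; first split => /=.
- by have [] := fP (b, i) bb.
- by have [] := fP (b, j) bb.
- by have [] := fP (b, k) bb.
Qed.

End Colorings.

(** * Homeomorphisms from colored maps of branch points *)

Lemma nbhs_seq (T : topologicalType) (I : eqType) (s : seq I) (A : I -> set T)
    (p : T) : (forall x, x \in s -> nbhs p (A x)) ->
  nbhs p [set q | forall x, x \in s -> A x q].
Proof.
elim: s => [|a s IH] h.
  by apply: filterS filterT => q _ x; rewrite in_nil.
have ha : nbhs p (A a) by apply: h; rewrite inE eqxx.
have hs : nbhs p [set q | forall x, x \in s -> A x q].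
  by apply: IH => x xs; apply: h; rewrite inE xs orbT.
apply: filterS (filterI ha hs) => q [aq sq] x.
by rewrite inE => /predU1P[->|/sq].
Qed.

Section Homeomorphisms.
Context {R : realType} (X : metricType R) (n : option nat).
Hypotheses (hn : at_least3 n) (hX : wazewski X n).
Implicit Types (x y z p q a b m : X) (c : X -> set X -> colors n) (g : sym X).

Let cX : compact [set: X]. Proof. by case: hX => -[]. Qed.

(** Each point off the interior of [W] is separated from p by a branch point. Compactness, used as
    near-covering along the filter of finite lists ordered by inclusion, makes one list [s] suffice
    for all of them. *)
Lemma comp_at_subbasis p (W : set X) : nbhs p W -> exists s : seq X,
  forall q, (forall b, b \in s -> branch b -> b <> p -> comp_at b p q) -> W q.
Proof.
move=> /nbhs_interior Wp.
pose up (s : seq X) : set (seq X) := [set s' : seq X | {subset s <= s'}].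
have FB : Filter (filter_from setT up).
  apply: filter_from_filter; first by exists [::].
  move=> s1 s2 _ _; exists (s1 ++ s2) => // s h; split => x xs; apply: h;
    by rewrite mem_cat xs ?orbT.
pose P (s : seq X) q := exists2 b, b \in s & [/\ branch b, b <> p & ~ comp_at b
  p q].
have cK : compact (~` W°).
  by apply: (subclosed_compact _ cX) => //; apply: open_closedC;
    exact: open_interior.
have [x Wx|s _ sP] := (iffLR (compact_near_coveringP _) cK) _ _ P FB.
  have px : p <> x by move=> px; apply: Wx; rewrite -px;
    exact: nbhs_singleton Wp.
  have [b [bb bp bx h]] := separating_branch hX px.
  exists (comp_at b x, up [:: b]); last first.
    move=> [q s] [/= bq bs]; exists b; first by apply: bs; rewrite inE.
    split => // bpq; apply: h.
    have qb : q <> b by exact: connected_component_sub bq.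
    by move/(comp_atP _ qb) : bpq => ->; apply/esym/comp_atP.
  split => /=; last by exists [:: b].
  apply: open_nbhs_nbhs; split; [exact: (open_comp_at hX)|].
  exact/comp_at_refl/nesym.
exists s => q sq; apply: contrapT => Wq.
have sup : up s s by [].
have [|b bs [bb bp h]] := sP s sup q; first by move=> /interior_subset.
by apply: h; exact: sq.
Qed.

Lemma continuous_comp_at (f : X -> X) p :
  (forall b, branch b -> b <> f p -> nbhs p (f @^-1` comp_at b (f p))) ->
  f q @[q --> p] --> f p.
Proof.
move=> h W /comp_at_subbasis[s sW].
pose A b := [set q | branch b -> b <> f p -> comp_at b (f p) (f q)].
have : nbhs p [set q | forall b, b \in s -> A b q].
  apply: nbhs_seq => b _; rewrite /A.
  have [bb|nb] := pselect (branch b); last by apply: filterS filterT => q _ ?.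
  have [bp|/eqP bp] := eqVneq b (f p);
    first by apply: filterS filterT => q _ _ /(_ bp).
  by apply: filterS (h b bb bp) => q fq _ _.
by apply: filterS => q Aq; apply: sW => b bs bb bp; exact: Aq.
Qed.

(** The combinatorial form of being a homeomorphism; the two directions are [tree_map_homeo] and
    [homeo_tree_map]. *)
Definition tree_map g := (forall b, branch (g b) <-> branch b) /\
  forall b p q, branch b -> p <> b -> q <> b ->
    comp_at (g b) (g p) = comp_at (g b) (g q) <-> comp_at b p = comp_at b q.

Lemma tree_mapV g : tree_map g -> tree_map (g^-1)%g.
Proof.
move=> [gb gc]; split => [b|b p q bb pb qb]; first by rewrite -gb symVE symVK.
rewrite -gc !symVE ?symVK //.
- by rewrite -gb symVK.
- by move/(can_inj (symVK g)).
- by move/(can_inj (symVK g)).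
Qed.

Lemma tree_map_continuous g : tree_map g -> continuous g.
Proof.
move=> [gb gc] p; apply: continuous_comp_at => b'.
rewrite -(symVK g b'); set b := sym_inv g b' => bb bp.
have {}bp : p <> b by move=> e; apply: bp; rewrite e.
have {}bb : branch b by apply/gb.
have : nbhs p (comp_at b p).
  by apply: open_nbhs_nbhs; split;
    [exact: (open_comp_at hX)|exact: comp_at_refl].
apply: filterS => q bpq; have qb : q <> b by exact: connected_component_sub bpq.
have gqb : g q <> g b by move=> /(can_inj (symK g)).
by apply/(comp_atP _ gqb)/gc => //; apply/(comp_atP _ qb).
Qed.

Lemma tree_map_homeo g : tree_map g -> homeos g.
Proof.
by move=> gt; split; apply: tree_map_continuous => //; exact: tree_mapV.
Qed.

Lemma homeo_tree_map g : homeos g -> tree_map g.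
Proof.
move=> gh; split => [b|b p q bb pb qb]; first exact: homeo_branch.
rewrite -!image_comp_at//; split=> [e|-> //].
have inj (A B : set X) : g @` A = g @` B -> A `<=` B.
  move=> AB z Az; have : (g @` B) (g z) by rewrite -AB; exists z.
  by case=> w Bw /(can_inj (symK g)) <-.
by apply/seteqP; split; exact: inj.
Qed.

Section Extension.
Variables (c c' : X -> set X -> colors n) (phi : X -> X).
Hypotheses (cc : coloring c) (cc' : coloring c').
Hypothesis phi_branch : forall b, branch b -> branch (phi b).
Hypothesis phi_col : forall a b, branch a -> branch b -> a <> b ->
  phi a <> phi b /\ color_at c' (phi a) (phi b) = color_at c a b.

(** When p is not a branch point, q is a cluster point of the images of branch points tending to p.
    Its color at [phi x] is forced, since the points in the component of p at x are sent into one
    component at [phi x]. *)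
Lemma extension_point p : exists q, (branch p -> q = phi p) /\
  forall b, branch b -> b <> p -> phi b <> q /\ color_at c' (phi b) q =
    color_at c b p.
Proof.
have [bp|nbp] := pselect (branch p).
  by exists (phi p); split => // b bb bp'; exact: phi_col.
have neq b : branch b -> p <> b by move=> bb pb; apply: nbp; rewrite pb.
pose S (s : seq X) := phi @` [set b | branch b /\
  forall x, x \in s -> branch x -> comp_at x p b].
have FF : ProperFilter (filter_from setT S).
  apply: filter_from_proper.
    apply: filter_from_filter; first by exists [::].
    move=> s1 s2 _ _; exists (s1 ++ s2) => // _ [b [bb bs] <-].
    by split; exists b => //; split => // x xs; apply: bs;
      rewrite mem_cat xs ?orbT.
  move=> s _.
  have : nbhs p [set b | forall x, x \in s -> branch x -> comp_at x p b].
    apply: nbhs_seq => x _.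
    have [bx|nx] := pselect (branch x); last by apply: filterS filterT => q _ ?.
    have : nbhs p (comp_at x p).
      apply: open_nbhs_nbhs; split; [exact: (open_comp_at hX)|].
      exact/comp_at_refl/neq.
    by apply: filterS.
  rewrite nbhsE => -[U [oU Up] US].
  by have [b bb Ub] := open_has_branch hX oU Up; exists (phi b), b => //;
    split => //; exact: US.
have [q [_ cq]] := cX FF (filterT : filter_from setT S setT).
have colq x : branch x -> q <> phi x -> color_at c' (phi x) q = color_at c x p.
  move=> bx qx.
  have Sx : filter_from setT S (S [:: x]) by exists [:: x].
  have nq : nbhs q (comp_at (phi x) q).
    by apply: open_nbhs_nbhs; split;
      [exact: (open_comp_at hX)|exact: comp_at_refl].
  have [_ [[b [bb bs] <-]]] := cq _ _ Sx nq.
  move=> qb; have xpb : comp_at x p b by apply: bs; rewrite ?inE.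
  have bx' : b <> x by exact: connected_component_sub xpb.
  have [pne pcol] := phi_col bx bb (nesym bx').
  have -> : color_at c' (phi x) q = color_at c' (phi x) (phi b).
    by apply/(col_comp_at cc' (phi_branch bx)) => //;
      [exact: nesym|apply/comp_atP => //; exact: nesym].
  by rewrite pcol; apply/esym/(col_comp_at cc bx) => //;
    [exact: neq|apply/comp_atP].
exists q; split => // b bb _.
(* Otherwise a branch point [y] separating b from p would have an image giving q both the color of b
   and that of p. *)
have qb : q <> phi b.
  move=> qb; have [y [by_ yb yp h]] := separating_col hX cc (nesym (neq b bb)).
  have [pne pcol] := phi_col by_ bb yb.
  by apply: h; rewrite -pcol -qb colq// qb; exact: nesym.
by split; [exact: nesym|exact: colq].
Qed.

End Extension.

Lemma colored_tree_branch c : kaleidoscopic c -> colored_tree (@branch R X)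
  (color_at c).
Proof.
move=> [cc ck]; split.
- by move=> a b p _ _ _ ab _ _; exact: (col_tree hX).
- move=> x y i j bx by_ xy ij;
  have [z [zxy bz zi zj]] := ck x y bx by_ xy i j ij.
  by exists z; move/(open_arcP hX _ xy) : zxy => -[].
- by move=> x i bx; exact: (col_onto hX).
- move=> x y z bx by_ bz xy xz yz.
  have [m [m1 m2 m3]] := median_exists hX xy xz yz.
  have bm := median_branch hX bx by_ bz xy xz yz m1 m2 m3.
  have S u v : u <> v -> arc u v m -> weak_sep (color_at c) m u v.
    move=> uv uvm; have [mu|/eqP mu] := eqVneq m u; first by constructor 1.
    have [mv|/eqP mv] := eqVneq m v; first by constructor 2.
    constructor 3 => /(col_comp_at cc bm (nesym mu) (nesym mv)).
    exact: (arc_sep hX uv uvm mu mv).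
  by exists m; split => //; exact: S.
Qed.

Lemma homeo_extend c c' (E : seq (X * X)) :
  kaleidoscopic c -> kaleidoscopic c' ->
  partial_iso (@branch R X) (color_at c) (color_at c') E -> E != [::] ->
  exists g : sym X, [/\ homeos g, forall u, u \in E -> g u.1 = u.2 &
    forall b p, branch b -> p <> b -> color_at c' (g b) (g p) = color_at c b p].
Proof.
move=> ck ck' piE E0; have [[cc _] [cc' _]] := (ck, ck').
have two (i : colors n) : exists j, j <> i.
  by have [j [_ [ji _ _]]] := other_colors i hn; exists j.
have [phi [psi [phiB psiB phic phiE]]] := back_and_forth
  (countable_branch hn hX cc) (colored_tree_branch ck) (colored_tree_branch ck')
  two piE E0.
have phi_col a b : branch a -> branch b -> a <> b ->
    phi a <> phi b /\ color_at c' (phi a) (phi b) = color_at c a b.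
  move=> ba bb ab; split; last exact: phic.
  move=> e; apply: ab; have [_ <-] := phiB a ba; have [_ <-] := phiB b bb.
  by rewrite e.
have psi_col a b : branch a -> branch b -> a <> b ->
    psi a <> psi b /\ color_at c (psi a) (psi b) = color_at c' a b.
  move=> ba bb ab; have [bpa pa] := psiB a ba; have [bpb pb] := psiB b bb.
  have ne : psi a <> psi b by move=> e; apply: ab; rewrite -pa -pb e.
  by split => //; rewrite -phic// pa pb.
have /choice[f fP] := extension_point cc cc' (fun b bb => (phiB b bb).1)
  phi_col.
have /choice[h hP] := extension_point cc' cc (fun b bb => (psiB b bb).1)
  psi_col.
(* Both maps preserve colors, and distinct points get distinct colors at some branch point. *)
have fK : cancel f h.
  move=> p; apply: contrapT => e.
  have [b [bb be bp]] := separating_col hX cc e; apply.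
  have [bpb pb] := phiB b bb.
  have [fb fc] := (fP p).2 b bb bp; have [_ hc] := (hP (f p)).2 _ bpb fb.
  by rewrite pb in hc; rewrite hc.
have hK : cancel h f.
  move=> p; apply: contrapT => e.
  have [b [bb be bp]] := separating_col hX cc' e; apply.
  have [bpb pb] := psiB b bb.
  have [fb fc] := (hP p).2 b bb bp; have [_ hc] := (fP (h p)).2 _ bpb fb.
  by rewrite pb in hc; rewrite hc.
have fphi b : branch b -> f b = phi b by exact: (fP b).1.
have fcol b p : branch b -> p <> b -> color_at c' (f b) (f p) = color_at c b p.
  by move=> bb pb; rewrite fphi//; have [_ ->] := (fP p).2 b bb (nesym pb).
exists (Sym fK hK); split => //=; last first.
  by move=> u uE; rewrite fphi ?phiE//; exact: (pi_dom piE).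
apply: tree_map_homeo; split => /= [b|b p q bb pb qb].
  split => [bb|bb]; last by rewrite fphi//; have [] := phiB b bb.
  by rewrite -(fK b) (hP _).1//; have [] := psiB _ bb.
have bf : branch (f b) by rewrite fphi//; have [] := phiB b bb.
rewrite -(col_comp_at cc' bf) ?fcol// ?(col_comp_at cc bb)//.
- by move/(can_inj fK).
- by move/(can_inj fK).
Qed.

End Homeomorphisms.
(** * Local actions and supports *)

Section KaleidoscopicGroup.
Context {R : realType} (X : metricType R) (n : option nat).
Hypotheses (hn : at_least3 n) (hX : wazewski X n).
Variables (c : X -> set X -> colors n) (Gamma : set (Symn n)).
Hypotheses (ck : kaleidoscopic c) (hG : is_subgroup Gamma).
Implicit Types (x y z p q b : X) (g k h : sym X).

Let cc : coloring c. Proof. by case: ck. Qed.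
Local Notation col := (color_at c).
Local Notation KG := (kaleidoscopic_group c Gamma).

Lemma kaleidoscopic_group_col g b : KG g -> branch b ->
  exists2 s : Symn n, Gamma s & forall q, q <> b -> col (g b) (g q) = s (col b
    q).
Proof.
move=> [gh gK] bb; have [s Gs sE] := gK b bb; exists s => // q qb.
have hq : hat b (comp_at b q) by exists q.
by rewrite -sE local_actionE// image_comp_at.
Qed.

Lemma col_kaleidoscopic_group g :
  (forall b, branch (g b) <-> branch b) ->
  (forall b, branch b -> exists2 s : Symn n, Gamma s &
     forall q, q <> b -> col (g b) (g q) = s (col b q)) -> KG g.
Proof.
move=> gb gs; have gh : homeos g.
  apply: (tree_map_homeo hX); split => // b p q bb pb qb.
  have [s _ sE] := gs b bb; have bg : branch (g b) by apply/gb.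
  have gneq w : w <> b -> g w <> g b by move=> wb /(can_inj (symK g)).
  apply: (iff_trans (iff_sym (col_comp_at cc bg (gneq p pb) (gneq q qb)))).
  rewrite !sE//; apply: iff_trans (col_comp_at cc bb pb qb).
  by split => [|-> //]; exact: (can_inj (symK s)).
suff gK : homeos g /\ forall b, branch b ->
  exists2 s : Symn n, Gamma s & local_action c g b = s :> (_ -> _) by exact: gK.
split => // b bb.
have [s Gs sE] := gs b bb; exists s => //.
apply: local_actionP => // _ [q qb <-].
by rewrite image_comp_at// -/(col (g b) (g q)) sE.
Qed.

(** From inside a component at p, everything outside it is seen in the direction of p.
    [comp_at_enter] is the converse view from outside. *)
Lemma comp_at_leave p y b q : comp_at p y b -> ~ comp_at p y q ->
  comp_at b q = comp_at b p.
Proof.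
move=> pyb pyq; have [->//|/eqP qp] := eqVneq q p.
have bp : b <> p by exact: connected_component_sub pyb.
have [e|//] := comp_at_tree hX q (nesym bp).
by case: pyq; apply/(comp_atP _ qp); rewrite e; exact/(comp_atP _ bp).
Qed.

Lemma comp_at_enter p y b q : p <> b -> ~ comp_at p y b -> comp_at p y q ->
  comp_at b q = comp_at b p.
Proof.
move=> pb pyb pyq; have qp : q <> p by exact: connected_component_sub pyq.
have [e|//] := comp_at_tree hX q pb.
case: pyb; apply/comp_atP; first exact: nesym.
by rewrite -e; apply/comp_atP.
Qed.

Lemma restriction_sym g (U : set X) : (forall q, U (g q) <-> U q) ->
  exists k : sym X, forall q, k q = if `[< U q >] then g q else q.
Proof.
move=> gU; pose f q := if `[< U q >] then g q else q.
pose f' q := if `[< U q >] then sym_inv g q else q.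
have gU' q : U (sym_inv g q) <-> U q by rewrite -gU symVK.
have fK : cancel f f'.
  move=> q; rewrite /f /f'; case: (asboolP (U q)) => Uq.
    by rewrite asboolT ?symK//; apply/gU.
  by rewrite asboolF.
have f'K : cancel f' f.
  move=> q; rewrite /f /f'; case: (asboolP (U q)) => Uq.
    by rewrite asboolT ?symVK//; apply/gU'.
  by rewrite asboolF.
by exists (Sym fK f'K).
Qed.

(** Cutting [g] off outside the component only changes points that a branch point b inside sees in
    the direction of p, which [g] fixes; so b keeps its local action. For b outside, a point of the
    component and its image are in the same direction, so the local action is trivial. *)
Lemma kaleidoscopic_restriction g p y : homeos g -> g p = p -> y <> p ->
  (forall q, comp_at p y (g q) <-> comp_at p y q) ->
  (forall b, branch b -> comp_at p y b -> exists2 s : Symn n, Gamma s &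
     forall q, q <> b -> col (g b) (g q) = s (col b q)) ->
  exists k : sym X, [/\ KG k, forall q, comp_at p y q -> k q = g q &
    forall q, ~ comp_at p y q -> k q = q].
Proof.
move=> gh gp yp gU gs; have [k kE] := restriction_sym gU.
have kin q : comp_at p y q -> k q = g q by move=> Uq; rewrite kE asboolT.
have kout q : ~ comp_at p y q -> k q = q by move=> Uq; rewrite kE asboolF.
exists k; split => //; apply: col_kaleidoscopic_group => [b|b bb].
  by rewrite kE; case: asboolP => _ //; exact: homeo_branch.
have [Ub|Ub] := pselect (comp_at p y b).
  have pb : p <> b by move=> e; move: Ub;
    rewrite -e => /connected_component_sub; exact.
  have pgb : p <> g b.
    by move=> e; move/gU : Ub; rewrite -e => /connected_component_sub; exact.
  have [s Gs sE] := gs b bb Ub; exists s => // q qb; rewrite kin//.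
  have [Uq|Uq] := pselect (comp_at p y q); first by rewrite kin// sE.
  rewrite kout//.
  have Ugb : comp_at p y (g b) by apply/gU.
  have := sE p pb; rewrite gp.
  by rewrite /color_at (comp_at_leave Ub Uq) (comp_at_leave Ugb Uq).
exists 1%g; first by case: hG.
move=> q qb; rewrite kout// sym1E.
have [Uq|Uq] := pselect (comp_at p y q); last by rewrite kout.
rewrite kin//; have [pb|/eqP pb] := eqVneq p b.
  have gq : comp_at p y (g q) by apply/gU.
  have qp : q <> p by rewrite pb.
  have gqp : g q <> p by exact: connected_component_sub gq.
  rewrite -pb /color_at; congr (c _ _).
  by rewrite -(iffLR (comp_atP y qp) Uq) -(iffLR (comp_atP y gqp) gq).
rewrite /color_at; congr (c _ _).
by rewrite (comp_at_enter pb Ub Uq) (comp_at_enter pb Ub) //; exact/gU.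
Qed.

Let c_between x y i j : branch x -> branch y -> x <> y -> i <> j ->
  exists z, [/\ branch z, z <> x, z <> y, col z x = i & col z y = j].
Proof. by move: (tree_kaleidoscopic (colored_tree_branch hX ck)); exact. Qed.

(** A map preserving colors from [c] to this coloring and sending x to y acts on the colors of [c]
    at x by [s]. *)
Definition recolor y (s : Symn n) : X -> set X -> colors n :=
  fun b C => if `[< b = y >] then sym_inv s (c b C) else c b C.

Lemma recolor_kaleidoscopic y s : branch y -> kaleidoscopic (recolor y s).
Proof.
move=> by_; have recE b C : b <> y -> recolor y s b C = c b C.
  by move=> /= h; rewrite /recolor asboolF.
split.
  move=> b bb; have [cf cI cS] := cc bb; have [bY|bY] := pselect (b = y).
    have recY C : recolor y s b C = sym_inv s (c b C) by rewrite /recolor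
      asboolT.
    split => //.
      by move=> C D hC hD; rewrite !recY => /(can_inj (symVK s)); exact: cI.
    move=> i _; have [C hC Ci] := cS (s i) Logic.I.
    by exists C => //; rewrite recY Ci symK.
  split => //.
    by move=> C D hC hD; rewrite !recE//; exact: cI.
  by move=> i _; have [C hC Ci] := cS i Logic.I; exists C => //; rewrite recE.
move=> x x' bx bx' xx' i j ij.
have [z [bz zx zx' zi zj]] := c_between bx bx' xx' ij.
have arcz w : w <> x -> w <> x' -> branch w -> col w x = i -> col w x' = j ->
  Defs.open_arc x x' w.
  move=> wx wx' bw wi wj; apply/(open_arcP hX _ xx'); split => // e.
  by apply: ij; rewrite -wi -wj /color_at e.
have [zY|zY] := pselect (z = y); last first.
  by exists z; split => //; [exact: arcz|rewrite recE|rewrite recE].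
(* The witness found is the recolored point y itself. A witness [w] between x and y is used instead;
   it sees x' in the direction of y. *)
subst z; have [w [bw wx wy wi wj]] := c_between bx by_ (nesym zx) ij.
have ywx : col y w <> col y x'.
  move=> e; have [e'|e'] := col_tree hX c x (nesym wy).
    by apply: ij; rewrite -zi -zj e'.
  by apply: ij; rewrite -wi -wj e'.
have wx' : w <> x' by move=> e; apply: ywx; rewrite e.
have wj' : col w x' = j.
  have [e|->//] := col_tree hX c x' (nesym wy).
  by case: ywx.
by exists w; split => //; [exact: arcz|rewrite recE|rewrite recE].
Qed.

(** Back-and-forth from [c] to [recolor y s], started at p -> p and x -> y, then restricted to the
    component of x at p. Points outside it are seen from x and from y in the direction of p, where
    the prescribed action of [s] is the last hypothesis. *)
Lemma kaleidoscopic_transport x y p (s : Symn n) : Gamma s ->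
  branch x -> branch y -> branch p -> p <> x -> p <> y ->
  comp_at p x = comp_at p y -> col y p = s (col x p) ->
  exists k : sym X, [/\ KG k, k x = y,
    forall q, q <> x -> col y (k q) = s (col x q) &
    forall q, ~ comp_at p x q -> k q = q].
Proof.
move=> Gs bx by_ bp px py pxy ypx; pose c' := recolor y s.
have c'E b q : b <> y -> color_at c' b q = col b q.
  by move=> h; rewrite /color_at /c' /recolor asboolF.
have c'y q : color_at c' y q = sym_inv s (col y q).
  by rewrite /color_at /c' /recolor asboolT.
have ck' : kaleidoscopic c' by exact: recolor_kaleidoscopic.
have piE : partial_iso (@branch R X) col (color_at c') [:: (p, p); (x, y)].
  split.
  - by move=> u; rewrite !inE => /orP[|] /eqP ->.
  - by move=> u; rewrite !inE => /orP[|] /eqP ->.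
  - by move=> u v; rewrite !inE => /orP[|] /eqP -> /orP[|] /eqP -> //=;
    split => /esym.
  - move=> u v; rewrite !inE => /orP[|] /eqP -> /orP[|] /eqP -> //= _.
      by rewrite c'E// /color_at pxy.
    by rewrite c'y ypx symK.
  - move=> u v w; rewrite !inE.
    by move=> /orP[|] /eqP -> /orP[|] /eqP -> /orP[|] /eqP -> //=.
have [g [gh gE gc]] := homeo_extend hn hX ck ck' piE isT.
have gp : g p = p by apply: (gE (p, p)); rewrite inE eqxx.
have gx : g x = y by apply: (gE (x, y)); rewrite !inE eqxx orbT.
have gU q : comp_at p x (g q) <-> comp_at p x q.
  have [->|/eqP qp] := eqVneq q p; first by rewrite gp.
  have gqp : g q <> p by rewrite -{1}gp => /(can_inj (symK g)).
  have := (homeo_tree_map gh).2 p x q bp (nesym px) qp.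
  by rewrite gp gx -pxy (comp_atP _ gqp) (comp_atP _ qp).
have gloc b q : branch b -> q <> b -> b <> x -> col (g b) (g q) = col b q.
  by move=> bb qb bx'; rewrite -(gc b q bb qb) c'E// -gx => /(can_inj (symK g)).
have glocx q : q <> x -> col y (g q) = s (col x q).
  by move=> qx; rewrite -(gc x)// gx c'y symVK.
have [|k [kK kin kout]] := kaleidoscopic_restriction gh gp (nesym px) gU.
  move=> b bb _; have [->|/eqP bx'] := eqVneq b x.
    by exists s => // q qx; rewrite gx glocx.
  by exists 1%g => [|q qb]; [case: hG|rewrite gloc].
have pxx : comp_at p x x by apply: comp_at_refl; exact: nesym.
exists k; split => //; first by rewrite kin.
move=> q qx; have [Uq|Uq] := pselect (comp_at p x q);
  first by rewrite kin// glocx.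
rewrite kout// /color_at.
have pyy : comp_at p x y by rewrite pxy; apply: comp_at_refl; exact: nesym.
rewrite (comp_at_leave pyy Uq) (comp_at_leave pxx Uq).
exact: ypx.
Qed.

End KaleidoscopicGroup.
(** * Commutators *)

Section Displacement.
Context {R : realType} (X : metricType R) (n : option nat).
Hypotheses (hn : at_least3 n) (hX : wazewski X n).
Variables (c : X -> set X -> colors n) (Gamma : set (Symn n)).
Hypotheses (ck : kaleidoscopic c) (hG : is_subgroup Gamma).
Implicit Types (x y z p q b : X) (g k h : sym X).

Let cc : coloring c. Proof. by case: ck. Qed.
Local Notation col := (color_at c).
Local Notation KG := (kaleidoscopic_group c Gamma).

(* [h] translates along an axis through [p] entering every [h^m p] through the
   color [j] and leaving it through another color, both different from [i]: the
   branches of color [i] hanging off the axis at the points [h^m p] are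
   therefore disjoint. *)
Lemma translation p (i : colors n) : branch p -> exists h : sym X,
  [/\ KG h,
    forall b q, branch b -> q <> b -> col (h b) (h q) = col b q &
    forall l m q, (l < m)%N ->
      (iter l h p <> q /\ col (iter l h p) q = i) ->
      (iter m h p <> q /\ col (iter m h p) q = i) -> False].
Proof.
move=> bp; have [j [k [ji ki jk]]] := other_colors i hn.
have ctree := colored_tree_branch hX ck.
have [w [bw wp pw]] := col_onto hX k cc bp.
(* [z] will be the image of p: the axis leaves p in the color [k], marked by [w], and enters [z] in
   the color [j]. *)
have [z [bz zp zw zj zi]] := tree_kaleidoscopic ctree bp bw (nesym wp) ji.
have pz : col p z = k.
  rewrite -pw; have [//|e] := col_tree hX c w (nesym zp).
  by case: ji; rewrite -zj -zi -e.
have piE : partial_iso (@branch R X) col col [:: (p, z)].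
  split.
  - by move=> u; rewrite inE => /eqP ->.
  - by move=> u; rewrite inE => /eqP ->.
  - by move=> u v; rewrite !inE => /eqP -> /eqP ->.
  - by move=> u v; rewrite !inE => /eqP -> /eqP -> /=.
  - by move=> u v w'; rewrite !inE => /eqP -> /eqP -> /=.
have [h [hh hE hc]] := homeo_extend hn hX ck ck piE isT.
have hp : h p = z by apply: (hE (p, z)); rewrite inE eqxx.
have hb b : branch (h b) <-> branch b by exact: homeo_branch.
pose P m := iter m h p.
have Pb m : branch (P m) by elim: m => //= m IH; apply/hb.
have hinj : injective h := can_inj (symK h).
(* Since [j] and [k] differ, the axis does not turn back at [P 1], and the first and last points see
   each other through it. *)
have step m : [/\ P 0%N <> P m.+1, col (P 0%N) (P m.+1) = k & col (P m.+1) (P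
  0%N) = j].
  elim: m => [|m [IH0 IH1 IH2]]; first by rewrite /P /= hp; split => //;
    exact: nesym.
  have e0 : P 1%N <> P m.+2 by move=> /hinj.
  have e1 : col (P 1%N) (P m.+2) = k by rewrite -IH1;
    exact: (hc _ _ (Pb 0%N) (nesym IH0)).
  have e2 : col (P m.+2) (P 1%N) = j by rewrite -IH2;
    exact: (hc _ _ (Pb m.+1) IH0).
  have e3 : col (P 1%N) (P 0%N) = j by rewrite /P /= hp.
  have e4 : P 0%N <> P m.+2 by move=> e; apply: jk; rewrite -e3 -e1 e.
  have e5 : P 1%N <> P 0%N by rewrite /P /= hp.
  split => //.
  - have [e|->] := col_tree hX c (P m.+2) e5; last by rewrite /P /= hp.
    by case: jk; rewrite -e3 -e1 e.
  - have [e|->//] := col_tree hX c (P 0%N) e0.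
    by case: jk; rewrite -e3 -e1 e.
have gen l m : [/\ P l <> P (l + m.+1)%N, col (P l) (P (l + m.+1)%N) = k &
    col (P (l + m.+1)%N) (P l) = j].
  elim: l => [|l [IH0 IH1 IH2]]; first exact: step.
  rewrite addSn; split; first by move=> /hinj.
  - by rewrite -IH1; exact: (hc _ _ (Pb l) (nesym IH0)).
  - by rewrite -IH2; exact: (hc _ _ (Pb _) IH0).
exists h; split => //.
  apply: (col_kaleidoscopic_group hX ck hb) => b bb.
  by exists 1%g => [|q qb]; [case: hG|rewrite hc].
(* [P l] sees [P m] in color [k] and [P m] sees [P l] in color [j]. A third point shows [k] at [P l]
   or [j] at [P m], and neither is [i]. *)
move=> l m q lm [lq lc] [mq mc].
have [e1 e2 e3] := gen l (m - l.+1)%N.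
move: e1 e2 e3; have -> : (l + (m - l.+1).+1 = m)%N by lia.
move=> e1 e2 e3; have [e|e] := col_tree hX c q e1.
- by case: ki; rewrite -lc -e2 -/(P l) e.
- by case: ji; rewrite -mc -e3 -/(P m) e.
Qed.

(* With [h] the translation above and [A] the infinite product of the
   conjugates of [a] by the powers of [h], one has [a = A (h A h^-1)^-1]. The
   product is a homeomorphism because it preserves the branches at all branch
   points, so no estimate on the diameters of the supports is needed. *)
Lemma supported_commutator p y a : branch p -> y <> p -> KG a ->
  (forall q, ~ comp_at p y q -> a q = q) ->
  exists u v : sym X, [/\ KG u, KG v & a = [~ u, v]%g].
Proof.
move=> bp yp aK aout; have [K1 KM KV] := kaleidoscopic_group_subgroup cc hG.
have [h [hK hc disj]] := translation (col p y) bp.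
have Uin q : comp_at p y q <-> p <> q /\ col p q = col p y.
  split=> [pq|[pq /(col_comp_at cc bp (nesym pq) yp) e]].
    have qp : q <> p by exact: connected_component_sub pq.
    split; first exact: nesym.
    by apply/(col_comp_at cc bp) => //; apply/esym/comp_atP.
  by apply/comp_atP; [exact: nesym|rewrite e].
pose H m : sym X := (h ^+ m)%g.
have HK m : KG (H m) by elim: m => [|m IH]; rewrite /H ?expg0// expgS;
  exact: KM.
have HE m q : H m q = iter m h q.
  by elim: m q => [|m IH] q; rewrite /H ?expg0// expgS symME /= -IH.
have Hinj m : injective (H m) := can_inj (symK (H m)).
have Hb m b : branch (H m b) <-> branch b by have [hh _] := HK m;
  exact: homeo_branch.
have Hc m b q : branch b -> q <> b -> col (H m b) (H m q) = col b q.
  move=> bb qb; elim: m => [|m IH]; first by rewrite /H expg0.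
  rewrite -IH /H expgS !symME hc//; first exact/Hb.
  by move=> /Hinj.
pose P m := H m p.
(* The m-th translate of the support of [a], named by its color at [P m] because [h] preserves
   colors. *)
pose C m q := P m <> q /\ col (P m) q = col p y.
have C0 q : C 0%N q <-> comp_at p y q by rewrite Uin /C /P /H expg0.
have CH m l q : C (m + l)%N (H m q) <-> C l q.
  have PE : P (m + l)%N = H m (P l) by rewrite /P !HE iterD.
  rewrite /C PE; split=> -[e1 e2].
    have e3 : P l <> q by move=> e; apply: e1; rewrite e.
    by split => //; rewrite -e2 Hc//; [exact/Hb|exact: nesym].
  have e3 : H m (P l) <> H m q by move/Hinj.
  by split => //; rewrite Hc//; [exact/Hb|exact: nesym].
have uniqC m l q : C m q -> C l q -> m = l.
  move=> mq lq; have [ml|lm|//] := ltngtP m l.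
  - by exfalso; apply: (disj m l q ml); rewrite -!HE.
  - by exfalso; apply: (disj l m q lm); rewrite -!HE.
have CHV m q : C m q <-> C 0%N (sym_inv (H m) q).
  by rewrite -(CH m 0%N) symVK addn0.
pose am (f : sym X) m : sym X := (H m * f * (H m)^-1)%g.
(* The infinite product of the conjugates of [f]; the index is unique by disjointness of the
   translates. *)
pose F (f : sym X) q := if pselect (exists m, C m q) is left e
  then am f (projT1 (cid e)) q else q.
have Fin f m q : C m q -> F f q = am f m q.
  rewrite /F; case: pselect => [e|h0] mq; last by case: h0; exists m.
  by have -> : projT1 (cid e) = m by apply: (uniqC _ _ q) => //; case: cid.
have Fout f q : ~ (exists m, C m q) -> F f q = q.
  by rewrite /F; case: pselect.
have amE f m q : am f m q = H m (f (sym_inv (H m) q)) by [].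
have pres (f : sym X) m q : (forall r, ~ comp_at p y r -> f r = r) -> C m (am f
  m q) <-> C m q.
  move=> fout; have fC r : C 0%N (f r) <-> C 0%N r.
    have [Cr|nCr] := pselect (C 0%N r); last first.
      by rewrite fout// -C0.
    split => // _; apply: contrapT => nfr.
    have : f (f r) = f r by apply: fout; rewrite -C0.
    by move=> /(can_inj (symK f)) e; apply: nfr; rewrite e.
  by rewrite amE (CHV m (H m _)) symK fC -CHV.
have aVout q : ~ comp_at p y q -> (a^-1)%g q = q.
  by move=> /aout e; rewrite -{1}e symVE symK.
have FK (f f' : sym X) : (forall r, ~ comp_at p y r -> f r = r) ->
    (forall r, f' (f r) = r) -> cancel (F f) (F f').
  move=> fout ff' q; have [[m mq]|nq] := pselect (exists m, C m q);
    last by rewrite !Fout.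
  rewrite (Fin f m q mq) (Fin f' m) ?pres// !amE symK ff' symVK//.
have AK := FK a (a^-1)%g aout (fun r => symK a r).
have AVK := FK (a^-1)%g a aVout (fun r => symVK a r).
pose A : sym X := Sym AK AVK.
have amK m : KG (am a m) by apply: (KM _ _ (KM _ _ (HK m) aK)); exact: KV.
have leave m b q : C m b -> ~ C m q -> col b q = col b (P m).
  move=> [mb bc] mq; have [<-//|/eqP qm] := eqVneq (P m) q.
  have [e|//] := col_tree hX c q mb.
  by case: mq; split => //; rewrite e.
have enter m b q : P m <> b -> ~ C m b -> C m q -> col b q = col b (P m).
  move=> mb nb [mq qc]; have [e|//] := col_tree hX c q mb.
  by case: nb; split => //; rewrite -e.
have AKG : KG A.
  apply: (col_kaleidoscopic_group hX ck) => [b|b bb].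
    rewrite /A /=; have [[m mb]|nb] := pselect (exists m, C m b);
      last by rewrite Fout.
    by rewrite (Fin _ m b mb); have [hm _] := amK m; exact: homeo_branch.
  (* Seen from a point off all translates, each translate lies in one direction, so the local action
     is trivial. In the m-th translate it is that of [am a m]: the other factors move points only
     outside it, all in the direction of [P m]. *)
  rewrite /A /=; have [[m mb]|nb] := pselect (exists m, C m b); last first.
    exists 1%g => [|q qb]; first by case: hG.
    rewrite (Fout _ b)// sym1E.
    have [[m mq]|nq] := pselect (exists m, C m q); last by rewrite Fout.
    have Fq : C m (F a q) by rewrite (Fin _ m q mq); apply/pres.
    have [e|/eqP e] := eqVneq (P m) b.
      by rewrite -e; case: Fq mq => _ -> [_ ->].
    have nmb : ~ C m b by move=> mb; apply: nb; exists m.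
    by rewrite (enter m b q)// (enter m b (F a q)).
  rewrite (Fin _ m b mb);
    have [s Gs sE] := kaleidoscopic_group_col ck (amK m) bb.
  exists s => // q qb; rewrite -sE//.
  have [mq|nmq] := pselect (C m q); first by rewrite (Fin _ m q mq).
  have amb : C m (am a m b) by apply/pres.
  rewrite (leave m _ (am a m q))// ?pres//; apply: leave => //.
  have [[l lq]|nq] := pselect (exists m, C m q); last by rewrite Fout.
  rewrite (Fin _ l q lq) => mF; apply: nmq.
  suff -> : m = l by [].
  by apply: uniqC mF _; apply/pres.
exists (A^-1)%g, (h^-1)%g; split; try exact: KV.
(* With [[~ u, v]] equal to u^-1 v^-1 u v, these inverses give A (h A^-1 h^-1). *)
have -> : [~ A^-1, h^-1]%g = (A * (h * (A^-1 * h^-1)))%g.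
  by rewrite commgEl conjgE !invgK !mulgA.
apply: symP => q; rewrite !symME; pose r := sym_inv h q.
have -> : (h^-1)%g q = r by [].
have hr : h r = q by rewrite /r symVK.
have shift m : C m.+1 q <-> C m r.
  by rewrite -(CH 1%N m) /H expg1 hr.
have AVr : (A^-1)%g r = F (a^-1)%g r by [].
have Aq w : A w = F a w by [].
(* For q in translate 0, [h^-1 q] lies in none and only the factor [a] acts. In translate m + 1 the
   factors of A and of h A^-1 h^-1 cancel, and elsewhere nothing moves. *)
rewrite AVr Aq; have [[[|m] mq]|nq] := pselect (exists m, C m q).
- have nr : ~ (exists m, C m r).
    by move=> [m /shift mr]; have := uniqC _ _ _ mq mr.
  by rewrite (Fout _ r)// hr (Fin _ _ _ mq) amE /H expg0.
- have mr : C m r by apply/shift.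
  have hF : h (am (a^-1)%g m r) = H m.+1 ((a^-1)%g (sym_inv (H m) r)).
    by rewrite amE /H expgS symME.
  have mF : C m.+1 (h (am (a^-1)%g m r)).
    have -> : h = H 1%N by rewrite /H expg1.
    by apply/(CH 1%N m)/pres.
  rewrite (Fin _ m r mr) (Fin _ _ _ mF) hF amE symK symVE symVK.
  have -> : H m.+1 (sym_inv (H m) r) = h r by rewrite /H expgS symME symVK.
  rewrite hr aout// => /C0 q0; have := uniqC _ _ _ mq q0; by [].
- have nr : ~ (exists m, C m r).
    by move=> [m /shift mr]; apply: nq; exists m.+1.
  rewrite (Fout _ r)// hr (Fout _ q)// aout// => /C0 q0.
  by apply: nq; exists 0%N.
Qed.

End Displacement.

(** * Factoring an element into two supported ones *)

Section ThreeCommutators.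
Context {R : realType} (X : metricType R) (n : option nat).
Hypotheses (hn : at_least3 n) (hX : wazewski X n).
Variables (c : X -> set X -> colors n) (Gamma : set (Symn n)).
Hypotheses (ck : kaleidoscopic c) (hG : is_subgroup Gamma).
Implicit Types (x y z p q b : X) (g k h : sym X).

Let cc : coloring c. Proof. by case: ck. Qed.
Local Notation col := (color_at c).
Local Notation KG := (kaleidoscopic_group c Gamma).

Lemma homeo_fixing_branch g : homeos g -> (forall b, branch b -> g b = b) ->
  g = 1%g.
Proof.
move=> [gC _] gb; apply: symP => q; rewrite sym1E; apply: contrapT => gq.
have [b [bb bgq bq h]] := separating_branch hX gq.
have [w bw [ww gw]] : exists2 w, branch w &
    (comp_at b q `&` g @^-1` comp_at b (g q)) w.
  apply: (open_has_branch hX (p := q)); last first.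
    by split; exact/comp_at_refl/nesym.
  apply: openI; first exact: (open_comp_at hX).
  by apply: open_comp => [z _|]; [exact: gC|exact: (open_comp_at hX)].
have wb : w <> b by exact: connected_component_sub ww.
rewrite /preimage /= (gb w bw) in gw.
by apply: h; rewrite (iffLR (comp_atP _ wb) ww) (iffLR (comp_atP _ wb) gw).
Qed.

(* Branches at [x] and [y = g x] are matched by [g]: any [p] in
   [g^-1 (comp_at y x)] works, unless that is the branch at [x] containing [y],
   in which case one takes [p] hanging off the arc between [x] and [y]. *)
Lemma moved_branch_witness g x : homeos g -> branch x -> g x <> x ->
  exists p, [/\ branch p, p <> x, p <> g x, comp_at p x = comp_at p (g x) &
    comp_at (g x) (g p) = comp_at (g x) p].
Proof.
move=> gh bx gx; set y := g x in gx *.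
pose e := sym_inv g x; have ge : g e = x by rewrite /e symVK.
have ex : e <> x by move=> E; apply: gx; rewrite /y -{1}E ge.
have gE p : p <> x -> comp_at x p = comp_at x e -> comp_at y (g p) = comp_at y
  x.
  by move=> px h; rewrite -ge; apply/(homeo_tree_map gh).2.
have [h|h] := pselect (comp_at x e = comp_at x y); last first.
  have [p bp pe] := open_has_branch hX (open_comp_at hX x e) (comp_at_refl ex).
  have px : p <> x by exact: connected_component_sub pe.
  have xpe : comp_at x p = comp_at x e by apply/esym/comp_atP.
  have py : p <> y by move=> E; apply: h; rewrite -xpe E.
  exists p; split => //.
    have [E|//] := comp_at_tree hX y (nesym px).
    by case: h; rewrite E.
  rewrite gE//; have [E|//] := comp_at_tree hX p (nesym gx).
  by case: h; rewrite -xpe E.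
have [m [bm mx my mxy]] := separating_branch hX (nesym gx).
(* A third color at [m]: a point [p] in that branch sees x and y on the same side, and both of them
   see it in the direction of [m]. *)
have [r [rx ry]] : exists r, r <> col m x /\ r <> col m y.
  have [j [k [jx kx jk]]] := other_colors (col m x) hn.
  by have [jy|jy] := pselect (j = col m y); [exists k; split => // ky;
    apply: jk; rewrite jy|exists j].
have [p [bp pm pr]] := col_onto hX r cc bm.
have off w : w <> m -> r <> col m w ->
    [/\ p <> w, comp_at w p = comp_at w m & comp_at p w = comp_at p m].
  move=> wm rw; have pw : p <> w by move=> E; apply: rw; rewrite -pr E.
  have mpw : comp_at m p <> comp_at m w by move=> E; apply: rw;
    rewrite -pr /color_at E.
  split => //.
    by have [E|//] := comp_at_tree hX p (nesym wm).
  by have [E|//] := comp_at_tree hX w (nesym pm); case: mpw.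
have [px xp pxm] := off x (nesym mx) rx;
  have [py yp pym] := off y (nesym my) ry.
have xy : comp_at x y = comp_at x m.
  by have [E|//] := comp_at_tree hX y mx; case: mxy; rewrite E.
have yx : comp_at y x = comp_at y m.
  by have [E|//] := comp_at_tree hX x my; case: mxy; rewrite -E.
exists p; split => //; first by rewrite pxm.
by rewrite gE ?yp ?yx// xp h xy.
Qed.

Lemma two_supported g : KG g -> g <> 1%g -> exists p y q z (u v : sym X),
  [/\ g = (u * v)%g,
    [/\ branch p, y <> p, KG u & forall w, ~ comp_at p y w -> u w = w] &
    [/\ branch q, z <> q, KG v & forall w, ~ comp_at q z w -> v w = w]].
Proof.
move=> gK g1; have [gh _] := gK.
have [K1 KM KV] := kaleidoscopic_group_subgroup cc hG.
have [x bx gx] : exists2 x, branch x & g x <> x.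
  apply: contrapT => h; apply: g1; apply: homeo_fixing_branch => // b bb.
  by apply: contrapT => gb; apply: h; exists b.
have by_ : branch (g x) by apply/homeo_branch.
have [p [bp px py pxy ypp]] := moved_branch_witness gh bx gx.
have [s Gs sE] := kaleidoscopic_group_col ck gK bx.
have [|k [kK kx kq kout]] := kaleidoscopic_transport hn hX ck hG Gs bx by_ bp
  px py pxy.
  by rewrite -sE// /color_at ypp.
pose f := (k^-1 * g)%g.
have fK : KG f by apply: KM => //; exact: KV.
have fx : f x = x by rewrite /f symME symVE -kx symK.
have kf q : k (f q) = g q by rewrite /f symME symVE symVK.
have [fh _] := fK.
have fc q : q <> x -> comp_at x (f q) = comp_at x q.
  move=> qx; have fqx : f q <> x by rewrite -fx => /(can_inj (symK f)).
  apply/(col_comp_at cc bx fqx qx); apply: (can_inj (symK s)).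
  by rewrite -kq// kf sE.
have fU q : comp_at x p (f q) <-> comp_at x p q.
  have [->|/eqP qx] := eqVneq q x; first by rewrite fx.
  have fqx : f q <> x by rewrite -fx => /(can_inj (symK f)).
  by rewrite (comp_atP _ fqx) (comp_atP _ qx) fc.
have [|a [aK ain aout]] := kaleidoscopic_restriction hX ck hG fh fx px fU.
  by move=> b bb _; exact: kaleidoscopic_group_col.
have aVK := KV _ aK.
have aVin q : comp_at x p q -> comp_at x p ((a^-1)%g q).
  move=> pq; apply: contrapT => npq; have := aout _ npq.
  by rewrite symVE symVK => e; apply: npq; rewrite symVE -e.
(* The element b of the overview is [f * a^-1]. *)
exists p, x, x, p, (k * (f * a^-1))%g, a; split.
- by rewrite -!mulgA mulVg mulg1 /f mulgA mulgV mul1g.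
- split => //; [exact: nesym|exact: (KM _ _ kK (KM _ _ fK aVK))|].
  (* Everything off the component of x at p lies in the component of p at x, where [a] agrees with
     [f]; so [f * a^-1] fixes [w], and [k] does too. *)
  move=> w nw; change (k (f ((a^-1)%g w)) = w);
    suff -> : f ((a^-1)%g w) = w by rewrite kout.
  have xpw : comp_at x p w.
    have wx : w <> x by move=> e; apply: nw; rewrite e;
      exact/comp_at_refl/nesym.
    apply/(comp_atP _ wx); have [->//|/eqP wp] := eqVneq w p.
    have [e|->//] := comp_at_tree hX w px.
    by case: nw; apply/(comp_atP _ wp).
  by rewrite -ain; [rewrite symVE symVK|exact: aVin].
- by split.
Qed.

Lemma two_commutators g : KG g -> exists u v u' v' : sym X,
  [/\ KG u, KG v, KG u', KG v' & g = ([~ u, v] * [~ u', v'])%g].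
Proof.
have [K1 _ _] := kaleidoscopic_group_subgroup cc hG.
move=> gK; have [->|g1] := pselect (g = 1%g).
  by exists 1%g, 1%g, 1%g, 1%g; split; rewrite // !commg1 mulg1.
have [p [y [q [z [a [b [-> [bp yp aK aout] [bq zq bK bout]]]]]]]] :=
  two_supported gK g1.
have [u [v [uK vK ->]]] := supported_commutator hn hX ck hG bp yp aK aout.
have [u' [v' [u'K v'K ->]]] := supported_commutator hn hX ck hG bq zq bK bout.
by exists u, v, u', v'.
Qed.

End ThreeCommutators.

Theorem theorem6p4 (R : realType) (n : option nat) (hn : at_least3 n)
    (Gamma : set (Symn n)) (hGamma : is_subgroup Gamma)
    (X : metricType R) (hX : wazewski X n)
    (c : X -> set X -> colors n) (hc : kaleidoscopic c) :
  uniformly_perfect (kaleidoscopic_group c Gamma) /\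
  forall g : sym X, kaleidoscopic_group c Gamma g ->
    product_of_commutators (kaleidoscopic_group c Gamma) 3 g.
Proof.
suff three g : kaleidoscopic_group c Gamma g ->
    product_of_commutators (kaleidoscopic_group c Gamma) 3 g.
  by split => //; exists 3%N.
have [cc _] := hc; have [K1 _ _] := kaleidoscopic_group_subgroup cc hGamma.
move=> /(two_commutators hn hX hc hGamma)[u [v [u' [v' [uK vK u'K v'K ->]]]]].
(* The default value of [nth] supplies a third, trivial commutator. *)
exists (fun i => nth 1%g [:: u; u'] i), (fun i => nth 1%g [:: v; v'] i).
split; try by case=> -[|[|[|i]]].
by rewrite !big_ord_recl big_ord0 /= comm1g !mulg1.
Qed.
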